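(* Let $\tau>1$, $\alpha>0$ be constants and $\eta>0$ a small parameter with $\tau\eta^\alpha<1$. For a piecewise continuous function $q$ on $[0,1]$ with $\sup|q|\le 1$, consider $\mathcal{D}_B[q](\lambda)=\int_0^1\sqrt{1+\frac{\eta^\alpha}{\lambda^2}q(s)}\,ds$ for all $\lambda\in[\sqrt{\tau\eta^\alpha},1]$. (1) The map $q\mapsto\mathcal{D}_B[q]$ is invariant under level-set preserving rearrangements of $q$. That is, given two functions $q_1$ and $q_2$ defined on $[0,1]$ such that $\sup|q_i|\le 1$ ($i=1,2$) which satisfy $$\mathrm{meas}\{q_1(t)=y,\ t\in[0,1]\}=\mathrm{meas}\{q_2(t)=y,\ t\in[0,1]\}\quad\text{for all } y\in[-1,1],$$ we have $\mathcal{D}_B[q_1]\equiv\mathcal{D}_B[q_2]$. (2) If $q\in C^1([0,1])$ is strictly increasing, $\sup|q|\le 1$, and $q^{-1}\in C^1([q(0),q(1)])$, then $\mathcal{D}_B[q]$ determines $q$ uniquely. The reconstruction problem can be formulated in terms of classical transforms in this case: there holds $$\frac1\lambda\mathcal{D}_B[q](\lambda)+\frac{d\mathcal{D}_B[q]}{d\lambda}(\lambda)=\frac{2}{\sqrt{\eta^\alpha}}\,\mathcal{L}F_0Q\left(\frac{\lambda}{\sqrt{\eta^\alpha}}\right),$$ where $Q$ is given by $Q(x)=\mathbf{1}_{(q(0),q(1))}(x^2)\,\frac{dq^{-1}}{dx}(x^2)$.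
   Context: $\mathcal{L}$ is the Laplace transform, $\mathcal{L}f(s)=\int_0^\infty e^{-st}f(t)\,dt$. $F_0$ is the Hankel transform $F_0f(s)=\int_0^\infty t f(t)J_0(st)\,dt$, where $J_0$ is the Bessel function of the first kind of order $0$. $\mathbf{1}_E$ is the indicator function of a set $E$, $\mathrm{meas}$ is Lebesgue measure, and $\frac{dq^{-1}}{dx}(x^2)$ denotes the derivative of the inverse function $q^{-1}$ evaluated at the point $x^2$.
   Formalization: In (1) the hypothesis is meas{q_1≥y}=meas{q_2≥y} instead of meas{q_1=y}=meas{q_2=y} (false as printed: q_1=t, q_2=t/2). In (2) the transform identity is stated only for q(0)≥0, as it fails for every q with q(0)<0; uniqueness keeps any sign of q(0). *)

(* Defs.v *)
From HB Require Import structures.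
From mathcomp Require Import all_boot all_order all_algebra.
From mathcomp Require Import all_classical all_reals all_analysis.
Set Implicit Arguments.
Unset Strict Implicit.
Unset Printing Implicit Defensive.
Import Order.TTheory GRing.Theory Num.Theory.
Import numFieldNormedType.Exports.
Local Open Scope classical_set_scope.
Local Open Scope ring_scope.

Section Defs.
Context {R : realType}.
Local Notation mu := (@lebesgue_measure R).
Implicit Types (f q : R -> R) (a b s x lam : R).

(* A function on an interval [a, b] is represented by a total function R -> R
   of which only the values on [a, b] are used. *)

(* Continuous on each open piece of a finite partition of [a, b], with finite
   one-sided limits at the ends of the pieces; the values at the partition
   points are arbitrary. *)
Definition piecewise_continuous f a b : Prop :=
  exists2 p : seq R, itv_partition a b p &
    forall i, (i < size p)%N ->
      let l := nth b (a :: p) i in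
      let r := nth b (a :: p) i.+1 in
      [/\ {in `]l, r[, forall x, {for x, continuous f}},
          cvg (f x @[x --> l^'+]) &
          cvg (f x @[x --> r^'-])].

(* C^1([a, b]) for a < b: continuous on [a, b], differentiable in the interior,
   with a derivative that extends continuously to [a, b]. *)
Definition C1 f a b : Prop :=
  derivable_oo_LRcontinuous f a b /\
  exists2 g : R -> R, {within `[a, b], continuous g} &
    {in `]a, b[, derive1 f =1 g}.

(* sup |q| <= 1 on [0, 1], written pointwise because the total operator [sup]
   is 0 on unbounded sets. *)
Definition bounded1 q : Prop := {in `[0, 1], forall s, `|q s| <= 1}.

(* D_B[q], for the parameters eta and alpha; the formula is used for all real
   lam, so that derivatives at the ends of a closed range of lam make sense. *)
Definition DB (eta alpha : R) q lam : R :=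
  \int[mu]_(s in `[0, 1])
     Num.sqrt (1 + (eta `^ alpha) / lam ^+ 2 * q s).

(* q1 and q2 are rearrangements of each other: all their level sets
   {q >= y} have the same measure. With {q = y} in place of {q >= y} all
   strictly increasing functions would be rearrangements of each other. *)
Definition same_level_measures (q1 q2 : R -> R) : Prop :=
  {in `[-1, 1], forall y : R,
    mu [set t | t \in `[0, 1] /\ y <= q1 t] =
    mu [set t | t \in `[0, 1] /\ y <= q2 t]}.

(* q^-1 : [q 0, q 1] -> [0, 1]; the value off q @` `[0, 1] is 0. *)
Definition qinv q : R -> R := 'pinv_(fun=> 0) `[0, 1] q.

Definition increasing_C1_profile q : Prop :=
  [/\ C1 q 0 1,
      {in `[0, 1] &, {homo q : s t / s < t}},
      bounded1 q &
      C1 (qinv q) (q 0) (q 1)].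

Definition Q_of q x : R :=
  \1_(`]q 0, q 1[ : set R) (x ^+ 2) * derive1 (qinv q) (x ^+ 2).

(* J_0(x) = sum_k (-1)^k / (k!)^2 * (x / 2)^(2 k). *)
Definition besselJ0 x : R :=
  limn (series (fun k => (-1) ^+ k / (k`!%:R) ^+ 2 * (x / 2) ^+ k.*2)).

Definition hankel0_integrand f s t : R := t * f t * besselJ0 (s * t).

Definition hankel0 f s : R :=
  \int[mu]_(t in `[0, +oo[) hankel0_integrand f s t.

Definition laplace_integrand f s t : R := expR (- (s * t)) * f t.

Definition laplace f s : R :=
  \int[mu]_(t in `[0, +oo[) laplace_integrand f s t.

End Defs.

(* Main.v *)
(**
Write c = eta^alpha / lambda^2, a number in (0, 1), and
H_p[q](c) = \int_0^1 (1 + c q)^p, so that D_B[q](lambda) = H_{1/2}[q](c).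

(1) If q1 and q2 are rearrangements of each other, the images of Lebesgue
measure on [0, 1] under q1 and q2 agree on rays, hence on all Borel sets.

(2) Differentiation under the integral gives c H_p' = p (H_p - H_{p-1}), so D_B
on an interval determines H_{1/2-n}(c) for every n, that is, all moments of
1 / (1 + c q) for a weighted measure. Polynomials p_n that are bounded on (0, 1]
and tend to 1_{x < t} sqrt x turn these moments into the measures of the sets
{q > y}, which determine a continuous increasing q.

The same identity gives D_B / lambda + D_B' = H_{-1/2}(c) / lambda. On the other
side, the substitution r = q^{-1}(t^2) expresses the moments of t Q(t) by those
of q; integrating the power series of J_0 term by term against t Q(t) and then
against e^{-sigma s} (sigma = lambda / sqrt(eta^alpha) > 1 makes all sums
dominated) produces the binomial series of H_{-1/2}(sigma^{-2}) / (2 sigma).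
*)
Require Import Defs.
From HB Require Import structures.
From mathcomp Require Import all_boot all_order all_algebra.
From mathcomp Require Import all_classical all_reals all_analysis.
From mathcomp Require Import measurable_realfun ring lra.
Import Order.TTheory GRing.Theory Num.Theory.
Import numFieldNormedType.Exports.
Local Open Scope classical_set_scope.
Local Open Scope ring_scope.
Set Implicit Arguments.
Unset Strict Implicit.
Unset Printing Implicit Defensive.

(** * Measure-theoretic preliminaries *)

Section dominated.
Context {d : measure_display} {T : measurableType d} {R : realType}.
Variables (mu : {measure set T -> \bar R}) (D : set T).

Lemma Rdominated_convergence (f_ : nat -> T -> R) (f g : T -> R) :
  measurable D ->
  (forall n, measurable_fun D (f_ n)) ->
  (forall x, D x -> f_ n x @[n --> \oo] --> f x) ->
  mu.-integrable D (EFin \o g) ->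
  (forall n x, D x -> `|f_ n x| <= g x) ->
  mu.-integrable D (EFin \o f) /\
  (\int[mu]_(x in D) f_ n x)%R @[n --> \oo] --> (\int[mu]_(x in D) f x)%R.
Proof.
move=> mD mf_ f_f ig f_g.
have Ef_f x : D x -> (f_ n x)%:E @[n --> \oo] --> (f x)%:E.
  by move=> Dx; apply: cvg_EFin; [exact: nearW|exact: f_f].
have mEf_ n : @measurable_fun _ _ T (\bar R) D (EFin \o f_ n).
  exact/measurable_EFinP.
have mEf : @measurable_fun _ _ T (\bar R) D (EFin \o f).
  exact: emeasurable_fun_cvg mEf_ Ef_f.
have [||||| if_ _ cf] := @dominated_convergence _ T R mu D mD
    (fun n => EFin \o f_ n) (EFin \o f) (EFin \o g).
- by [].
- by [].
- exact: aeW.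
- by [].
- by apply: aeW => x n Dx /=; rewrite lee_fin f_g.
split=> //; apply: fine_cvg; rewrite /Rintegral fineK//.
exact: integrable_fin_num.
Qed.

Lemma integrable_EFinB (f g : T -> R) : measurable D ->
  mu.-integrable D (EFin \o f) -> mu.-integrable D (EFin \o g) ->
  mu.-integrable D (EFin \o (fun x => f x - g x)).
Proof. by move=> mD fi gi; apply: eq_integrable (integrableB mD fi gi). Qed.

Lemma integrable_EFinZl (k : R) (f : T -> R) : measurable D ->
  mu.-integrable D (EFin \o f) ->
  mu.-integrable D (EFin \o (fun x => k * f x)).
Proof. by move=> mD fi; apply: eq_integrable (integrableZl mD k fi). Qed.

Lemma integrable_EFin_sum (n : nat) (f : nat -> T -> R) : measurable D ->
  (forall k, mu.-integrable D (EFin \o f k)) ->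
  mu.-integrable D (EFin \o (fun x => \sum_(0 <= k < n) f k x)).
Proof.
move=> mD fi; elim: n => [|n IH].
  by apply: eq_integrable (integrable0 _ _) => // x _; rewrite /= big_geq.
apply: eq_integrable (integrableD mD IH (fi n)) => // x _.
by rewrite /= big_nat_recr.
Qed.

Lemma Rintegral_sum (n : nat) (f : nat -> T -> R) : measurable D ->
  (forall k, mu.-integrable D (EFin \o f k)) ->
  \int[mu]_(x in D) (\sum_(0 <= k < n) f k x) =
  \sum_(0 <= k < n) \int[mu]_(x in D) f k x.
Proof.
move=> mD fi; elim: n => [|n IH].
  rewrite big_geq//; under eq_Rintegral do rewrite big_geq//.
  by rewrite Rintegral_cst// mul0r.
rewrite big_nat_recr//= -IH -RintegralD//; last exact: integrable_EFin_sum.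
by apply: eq_Rintegral => x _; rewrite big_nat_recr.
Qed.

End dominated.

(** * Laws of functions on [0, 1] and their superlevel sets *)

Section law.
Context {R : realType}.
Local Notation mu := (@lebesgue_measure R).

(** Induction on the partition: [f] is continuous on the first open piece, and adding the single
    point [a] preserves measurability whatever the value there. *)
Lemma measurable_fun_piecewise (f : R -> R) (a b : R) (p : seq R) :
  itv_partition a b p ->
  (forall i, (i < size p)%N ->
    {in `]nth b (a :: p) i, nth b (a :: p) i.+1[, forall x, {for x, continuous f}}) ->
  measurable_fun `[a, b] f.
Proof.
elim: p a => [|x p IH] a abp cf.
  by rewrite (itv_partition_nil abp) set_itv1; exact: measurable_fun_set1.
have /andP[ax _] : (a < x) && path <%R x p by case: abp.
have xb : x <= b by apply: itv_partition_le (itv_partition_cons abp).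
have -> : `[a, b]%classic = `[a, x[ `|` `[x, b] :> set R.
  by apply: itv_bndbnd_setU; rewrite bnd_simp // ltW.
apply/measurable_funU => //; split.
  apply/measurable_fun_itv_obnd_cbndP.
  apply: open_continuous_measurable_fun => // y /set_mem ay.
  exact: (cf 0%N).
by apply: IH => [|i ip]; [exact: itv_partition_cons abp|exact: (cf i.+1)].
Qed.

Local Notation I01 := (`[0, 1]%classic : set R).
Local Notation unif := (@uniform_prob R 0 1 (@ltr01 R)).

(** Closed right rays are stable under intersection and generate the Borel sets, and the rays
    starting at [- k] exhaust the line with finite measure, so uniqueness of measures applies. *)
Lemma measure_eq_rays (m1 m2 : {measure set R -> \bar R}) :
  (forall y : R, m1 `[y, +oo[%classic = m2 `[y, +oo[%classic) ->
  (forall y : R, (m1 `[y, +oo[%classic < +oo)%E) ->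
  forall A, measurable A -> m1 A = m2 A.
Proof.
move=> m12 m1fin.
apply: (measure_unique (@RGenCInfty.G R) (fun k => `[- k%:R, +oo[%classic)).
- exact: RGenCInfty.measurableE.
- move=> _ _ [x ->] [y ->]; exists (Num.max x y).
  by apply/seteqP; split => t /=; rewrite !in_itv/= !andbT ge_max => /andP.
- by move=> k; exists (- k%:R).
- apply/seteqP; split => // x _; exists (Num.bound `|x|) => //=.
  rewrite in_itv/= andbT lerNl ltW//.
  by rewrite (le_lt_trans (ler_norm _))// normrN archi_boundP.
- by move=> _ [y ->].
- by move=> k; exact: m1fin.
Qed.

Lemma uniform01E (A : set R) : measurable A -> unif A = mu (`[0, 1] `&` A).
Proof.
move=> mA; rewrite -[A in LHS]setIT -integral_indic//.
rewrite integral_uniform//; last exact/measurable_EFinP/measurable_indic.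
by rewrite subr0 invr1 mul1e integral_indic// setIC.
Qed.

(** Both sides are integrals of [g] against the laws of [q1] and [q2] under the uniform probability
    on [0, 1], and these laws agree on rays. *)
Lemma Rintegral01_comp_rays (g q1 q2 : R -> R) :
  measurable_fun I01 q1 -> measurable_fun I01 q2 ->
  (forall y, mu [set t | t \in `[0, 1] /\ y <= q1 t] =
             mu [set t | t \in `[0, 1] /\ y <= q2 t]) ->
  measurable_fun setT g -> (forall x, 0 <= g x) ->
  \int[mu]_(t in `[0, 1]) g (q1 t) = \int[mu]_(t in `[0, 1]) g (q2 t).
Proof.
move=> mq1 mq2 q12 mg g0.
(* Extension by 0 off [0, 1] gives a function measurable on the whole line, whose law under [unif]
   is a pushforward. *)
pose r (q : R -> R) := q \_ I01.
have mr (q : R -> R) : measurable_fun I01 q -> measurable_fun setT (r q).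
  by move=> mq; apply/(measurable_restrictT _ _).1.
have intE (q : R -> R) : measurable_fun I01 q ->
    (\int[mu]_(t in I01) (g (q t))%:E =
     \int[pushforward unif (r q)]_y (g y)%:E)%E.
  move=> mq; rewrite ge0_integral_pushforward//=; first last.
  - by move=> y _; rewrite lee_fin.
  - exact/measurable_EFinP.
  - exact: mr.
  rewrite preimage_setT integral_uniform//=; first last.
  - by move=> x; rewrite lee_fin.
  - by apply/measurable_EFinP/measurableT_comp => //; exact: mr.
  rewrite subr0 invr1 mul1e; apply: eq_integral => x xD.
  by rewrite /r patchE xD.
have rayE (q : R -> R) y : measurable_fun I01 q ->
    pushforward unif (r q) `[y, +oo[%classic = mu [set t | t \in `[0, 1] /\ y <= q t].
  move=> mq; rewrite /pushforward uniform01E; last first.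
    by rewrite -[X in measurable X]setTI; exact: mr.
  have rE t : 0 <= t <= 1 -> r q t = q t.
    by move=> t01; rewrite /r patchE mem_set//= in_itv.
  by congr (mu _); apply/seteqP; split => t /=; rewrite !in_itv/= => -[t01];
    rewrite !andbT rE.
rewrite /Rintegral (intE _ mq1) (intE _ mq2); congr fine.
apply: (@eq_measure_integral _ _ R setT (pushforward unif (r q2))
  (pushforward unif (r q1))); [exact: mr|exact: mr|].
move=> mr2 mr1 A + _; move: A.
apply: (@measure_eq_rays (pushforward unif (r q1)) (pushforward unif (r q2))) => //.
- by move=> y; have := q12 y; rewrite -!rayE.
- move=> y; apply: (@le_lt_trans _ _ 1%E); last exact: ltry.
  rewrite /pushforward; apply: probability_le1.
  by rewrite -[X in measurable X]setTI; exact: mr1.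
Qed.

(** The hypothesis concerns levels in [-1, 1] only; since both functions are bounded by 1, a
    superlevel set is all of [0, 1] below that range and empty above it. *)
Lemma Rintegral01_same_level_measures (g q1 q2 : R -> R) :
  measurable_fun I01 q1 -> measurable_fun I01 q2 ->
  bounded1 q1 -> bounded1 q2 -> same_level_measures q1 q2 ->
  measurable_fun setT g -> (forall x, 0 <= g x) ->
  \int[mu]_(t in `[0, 1]) g (q1 t) = \int[mu]_(t in `[0, 1]) g (q2 t).
Proof.
move=> mq1 mq2 b1 b2 q12 mg g0; apply: Rintegral01_comp_rays => // y.
have [y1|y1] := leP y (-1).
  congr (mu _); apply/seteqP; split => t /= [t01 _]; split=> //;
    rewrite (le_trans y1)// lerNl (le_trans (ler_norm _))// normrN.
    exact: b2.
  exact: b1.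
have [y2|y2] := leP y 1; first by apply: q12; rewrite in_itv/= (ltW y1).
congr (mu _); apply/seteqP; split => t /= [t01 yq]; exfalso; move: yq; apply/negP;
  rewrite -ltNge (le_lt_trans _ y2)// (le_trans (ler_norm _))//.
  exact: b1.
exact: b2.
Qed.

End law.

(** * Power means *)

Section power_mean.
Context {R : realType}.
Local Notation mu := (@lebesgue_measure R).
Local Notation I01 := (`[0, 1]%classic : set R).

Lemma integrable01 (f : R -> R) (M : R) : measurable_fun I01 f ->
  (forall t, I01 t -> `|f t| <= M) -> mu.-integrable I01 (EFin \o f).
Proof.
move=> mf fM; apply: measurable_bounded_integrable => //.
  by rewrite /= lebesgue_measure_itv/= lte_fin ltr01 sube0 ltry.
exists M; split; first exact: num_real.
by move=> x Mx t It /=; rewrite (le_trans (fM _ It))// ltW.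
Qed.

(** The power is monotone in its base, so one endpoint bounds it; the sum of both endpoint values
    covers either sign of [p]. *)
Lemma powR_le_endpoints (m M a p : R) : 0 < m -> m <= a <= M ->
  a `^ p <= m `^ p + M `^ p.
Proof.
move=> m0 /andP[ma aM]; have a0 := lt_le_trans m0 ma.
have [p0|p0] := leP 0 p.
  by apply: ler_wpDl; rewrite ?powR_ge0// ge0_ler_powR// nnegrE ltW// (lt_le_trans a0).
apply: ler_wpDr; first exact: powR_ge0.
rewrite -[p]opprK (powRN a) (powRN m) lef_pV2 ?posrE ?powR_gt0//.
by rewrite ge0_ler_powR ?nnegrE ?oppr_ge0// ltW.
Qed.

(** This is [H_p[q](c)]; no p-th root is taken. *)
Definition power_mean (p : R) (q : R -> R) (c : R) : R :=
  \int[mu]_(s in `[0, 1]) (1 + c * q s) `^ p.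

Variable q : R -> R.
Hypotheses (mq : measurable_fun I01 q) (bq : bounded1 q).

Lemma affine_bounds (u v c t : R) : 0 < u -> v < 1 -> c \in `]u, v[ -> I01 t ->
  1 - v <= 1 + c * q t <= 2.
Proof.
move=> u0 v1; rewrite in_itv/= => /andP[uc cv] t01.
have : `|q t| <= 1 by exact: bq.
rewrite ler_norml => /andP[q1 q2]; nra.
Qed.

Lemma measurable_affine_powR (p c : R) : measurable_fun I01 (fun t => (1 + c * q t) `^ p).
Proof.
apply: (measurableT_comp (measurable_powR p)).
by apply: measurable_funD => //; exact: measurable_funM.
Qed.

Lemma integrable_affine_powR (p c : R) : 0 < c < 1 ->
  mu.-integrable I01 (EFin \o (fun t => (1 + c * q t) `^ p)).
Proof.
move=> /andP[c0 c1].
have cI : c \in `]c / 2, (1 + c) / 2[ by rewrite in_itv/=; apply/andP; split; lra.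
apply: (@integrable01 _ ((1 - (1 + c) / 2) `^ p + 2 `^ p)).
  exact: measurable_affine_powR.
move=> t It; rewrite ger0_norm ?powR_ge0//; apply: powR_le_endpoints; first lra.
by apply: affine_bounds cI It; lra.
Qed.

(** Differentiation under the integral gives the integral of [p q (1 + c q)^(p - 1)], and
    [c q = (1 + c q) - 1] splits it into two power means. *)
Lemma is_derive_power_mean (p c : R) : 0 < c < 1 ->
  is_derive c 1 (power_mean p q)
    (p / c * (power_mean p q c - power_mean (p - 1) q c)).
Proof.
move=> /[dup] c01 /andP[c0 c1].
(* A neighbourhood of [c] inside (0, 1) on which the base stays in [1 - v, 2], away from 0. *)
pose u := c / 2; pose v := (1 + c) / 2.
have u0 : 0 < u by rewrite /u; lra.
have v1 : v < 1 by rewrite /v; lra.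
have cI : c \in `]u, v[ by rewrite in_itv/= /u /v; apply/andP; split; lra.
have pos x t : x \in `]u, v[ -> I01 t -> 0 < 1 + x * q t.
  move=> xI It; have /andP[+ _] := affine_bounds u0 v1 xI It.
  by apply: lt_le_trans; lra.
pose f x t := (1 + x * q t) `^ p.
have df x t : x \in `]u, v[ -> I01 t ->
    is_derive x 1 (f ^~ t) (p * (1 + x * q t) `^ (p - 1) * q t).
  move=> xI It.
  have d1 : is_derive x 1 (fun x => 1 + x * q t) (q t).
    by apply: is_derive_eq; rewrite /GRing.scale/=; ring.
  have d2 := @is_derive1_powR R p _ (pos _ _ xI It).
  exact: (@is_derive1_comp R (fun a => a `^ p) (fun x => 1 + x * q t) x _ _ d2 d1).
have dfE x t : x \in `]u, v[ -> I01 t ->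
    partial1of2 f x t = p * (1 + x * q t) `^ (p - 1) * q t.
  by move=> xI It; rewrite partial1of2E; have [] := df _ _ xI It.
(* Constant majorant of the partial derivative, valid for every parameter in []u, v[] because
   [|q| <= 1]. *)
pose C := `|p| * ((1 - v) `^ (p - 1) + 2 `^ (p - 1)).
have fI x : x \in `]u, v[ -> mu.-integrable I01 (EFin \o f x).
  rewrite in_itv/= => /andP[ux xv]; apply: integrable_affine_powR.
  by rewrite (lt_trans u0)//= (lt_trans xv).
have C0 : 0 <= C by rewrite mulr_ge0// addr_ge0 ?powR_ge0.
have CI : mu.-integrable I01 (EFin \o (cst C : R -> R)).
  by apply: (@integrable01 _ C) => // t _; rewrite /= ger0_norm.
have fub x t : x \in `]u, v[ -> I01 t -> `|partial1of2 f x t| <= C.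
  move=> xI It; rewrite dfE// normrM -[leRHS]mulr1 ler_pM//; last exact: bq.
  rewrite normrM ler_wpM2l// ger0_norm ?powR_ge0//.
  apply: powR_le_endpoints; first lra.
  exact: affine_bounds xI It.
have intE : \int[mu]_(t in I01) partial1of2 f c t =
    p / c * (power_mean p q c - power_mean (p - 1) q c).
  rewrite -RintegralB//; [|exact: integrable_affine_powR..].
  rewrite -RintegralZl//; last first.
    by apply: integrable_EFinB => //; exact: integrable_affine_powR.
  apply: eq_Rintegral => t /set_mem It; rewrite dfE//.
  have x0 := pos _ _ cI It.
  have -> : (1 + c * q t) `^ p = (1 + c * q t) `^ (p - 1) * (1 + c * q t).
    rewrite -[X in _ = _ * X](powRr1 (ltW x0)) -powRD ?subrK//.
    by rewrite (gt_eqF x0) implybT.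
  by field; rewrite gt_eqF.
rewrite -intE.
have der x t : `]u, v[%classic x -> I01 t -> derivable (f ^~ t) x 1.
  by move=> xI It; have [] := df x t xI It.
split.
  by apply: (@derivable_under_integral R _ _ mu f I01 _ c u v cI fI der (cst C)
    (fun=> C0) CI fub).
rewrite -derive1E.
by apply: (@differentiation_under_integral R _ _ mu f I01 _ c u v cI fI der
  (cst C) (fun=> C0) CI fub).
Qed.

End power_mean.

(** * Uniqueness *)

Section step_approximation.
Context {R : realType}.
Implicit Types (x y t r : R) (m n : nat).

Lemma bernoulli_ge x n : -1 <= x -> 1 + n%:R * x <= (1 + x) ^+ n.
Proof.
move=> x1; elim: n => [|n IH]; first by rewrite mul0r addr0 expr0.
rewrite exprS; apply: (@le_trans _ _ ((1 + x) * (1 + n%:R * x))).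
  have nx2 : 0 <= n%:R * x ^+ 2 by rewrite mulr_ge0// sqr_ge0.
  by rewrite -natr1; lra.
by rewrite ler_wpM2l//; lra.
Qed.

(** With [r = s^2] and [1 / s = 1 + h], Bernoulli's inequality gives [n h <= s^(-n)], hence
    [n r^n <= s^n / h]. *)
Lemma cvg_natM_expr r : 0 < r < 1 -> n%:R * r ^+ n @[n --> \oo] --> (0 : R).
Proof.
move=> /andP[r0 r1].
pose s := Num.sqrt r; pose h := s^-1 - 1.
have s0 : 0 < s by rewrite sqrtr_gt0.
have s1 : s < 1 by rewrite -[ltRHS]sqrtr1 ltr_sqrt.
have h0 : 0 < h by rewrite subr_gt0 invf_gt1.
apply: (@squeeze_cvgr _ _ _ _ (cst 0) (fun n => h^-1 * s ^+ n)).
- apply: nearW => n; apply/andP; split.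
    by rewrite mulr_ge0// exprn_ge0// ltW.
  have -> : r = s * s by rewrite -expr2 sqr_sqrtr// ltW.
  rewrite exprMn mulrA ler_pM2r ?exprn_gt0//.
  rewrite -ler_pdivlMr ?exprn_gt0// -ler_pdivrMl ?invr_gt0// invrK.
  have hs : 1 + h = s^-1 by rewrite /h addrC subrK.
  have h1 : -1 <= h by lra.
  by have := bernoulli_ge n h1; rewrite hs exprVn; lra.
- exact: cvg_cst.
- rewrite -[X in _ --> X](mulr0 h^-1); apply: cvgMr => //.
  by apply: cvg_expr; rewrite ger0_norm// ltW.
Qed.

(** The exponent [m] is about [n / t^n]. If [x < t], then [m x^n <= n (x / t)^n] tends to 0 and
    Bernoulli pushes the power to 1. If [t <= x], then [m x^n] grows at least like [n] and the power
    tends to 0. *)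
Lemma cvg_step t x : 0 < t <= 1 -> 0 <= x <= 1 ->
  (1 - x ^+ n) ^+ Num.truncn (n%:R / t ^+ n) @[n --> \oo] --> ((x < t)%R%:R : R).
Proof.
move=> /andP[t0 t1] /andP[x0 x1].
pose m n := Num.truncn (n%:R / t ^+ n : R).
have tn n : 0 <= n%:R / t ^+ n by rewrite divr_ge0// exprn_ge0// ltW.
have xn n : 0 <= x ^+ n <= 1 by rewrite exprn_ge0//= exprn_ile1.
have [xt|tx] := ltP x t.
- apply: (@squeeze_cvgr _ _ _ _ (fun n => 1 - n%:R * (x / t) ^+ n) (cst 1)).
  + apply: nearW => n; have /andP[xn0 xn1] := xn n.
    rewrite exprn_ile1 ?andbT; [|lra|lra].
    apply: (@le_trans _ _ (1 + (m n)%:R * - x ^+ n)).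
      rewrite mulrN lerD2l lerN2 expr_div_n [x ^+ n / _]mulrC mulrA ler_wpM2r//.
      by have /andP[] := truncn_itv (tn n).
    by apply: bernoulli_ge; lra.
  + rewrite -[X in _ --> X]subr0; apply: cvgB; first exact: cvg_cst.
    have [->|xN0] := eqVneq x 0.
      rewrite mul0r; apply: cvg_near_cst; exists 1%N => // n /= n0.
      by rewrite expr0n -[n == 0%N]negbK -lt0n n0 mulr0.
    have xp : 0 < x by rewrite lt0r xN0.
    by apply: cvg_natM_expr; rewrite divr_gt0//= ltr_pdivrMr// mul1r.
  + exact: cvg_cst.
- rewrite -cvg_shiftS.
  apply: (@squeeze_cvgr _ _ _ _ (cst 0) (fun n => n.+1%:R^-1)).
  + apply: nearW => n; have /andP[xn0 xn1] := xn n.+1.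
    rewrite exprn_ge0 /=; last by lra.
    set k := Num.truncn _; set y := x ^+ n.+1 in xn0 xn1 *.
    (* Truncation loses less than 1, and [t^(n+1) <= y <= 1], so the loss costs at most [y <= 1]. *)
    have ky : n.+1%:R <= 1 + k%:R * y.
      have /andP[_ /ltW] := truncn_itv (tn n.+1); rewrite -/k -[k.+1%:R]natr1 => tk.
      have : n.+1%:R <= n.+1%:R / t ^+ n.+1 * y.
        rewrite mulrAC ler_pdivlMr ?exprn_gt0// ler_wpM2l//.
        by rewrite lerXn2r// nnegrE// ltW.
      move/le_trans; apply; apply: (@le_trans _ _ ((k%:R + 1) * y)).
        by rewrite ler_wpM2r// ltW.
      by rewrite mulrDl mul1r addrC lerD2r.
    have ky0 : 0 < 1 + k%:R * y by apply: lt_le_trans ky.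
    apply: (@le_trans _ _ (1 + k%:R * y)^-1); last by rewrite lef_pV2// posrE.
    rewrite -[leRHS]mul1r ler_pdivlMr//.
    (* By Bernoulli [1 + k y <= (1 + y)^k], and the product is [(1 - y^2)^k <= 1]. *)
    apply: (@le_trans _ _ ((1 - y) ^+ k * (1 + y) ^+ k)).
      by rewrite ler_wpM2l ?exprn_ge0 ?subr_ge0// bernoulli_ge//; lra.
    rewrite -exprMn exprn_ile1//; first by apply: mulr_ge0; lra.
    by have := sqr_ge0 y; rewrite expr2; lra.
  + exact: cvg_cst.
  + exact: cvg_harmonic.
Qed.

(* Newton iteration for the square root; every iterate is a polynomial. *)
Fixpoint newton_sqrt (n : nat) : {poly R} :=
  if n is n'.+1 then
    newton_sqrt n' + 2^-1 *: ('X - newton_sqrt n' ^+ 2)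
  else 0.

Lemma newton_sqrt_bounds n x : 0 <= x <= 1 ->
  0 <= (newton_sqrt n).[x] <= Num.sqrt x /\
  Num.sqrt x - (newton_sqrt n).[x] <= Num.sqrt x * (1 - Num.sqrt x / 2) ^+ n.
Proof.
move=> /andP[x0 x1]; set r := Num.sqrt x.
have r0 : 0 <= r by exact: sqrtr_ge0.
have r1 : r <= 1 by rewrite -[leRHS]sqrtr1 ler_sqrt.
elim: n => [|n [/andP[y0 yr] IH]] /=; first by rewrite horner0 lexx r0 subr0 expr0 mulr1.
rewrite !hornerE; set y := (newton_sqrt n).[x] in y0 yr IH *.
have rr : x = r ^+ 2 by rewrite sqr_sqrtr.
rewrite rr; clearbody y; split.
  by apply/andP; split; rewrite expr2; nra.
rewrite [_ ^+ n.+1]exprSr mulrA; apply: (@le_trans _ _ ((r - y) * (1 - r / 2))).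
  by rewrite !expr2; nra.
by rewrite ler_wpM2r//; lra.
Qed.

Lemma cvg_newton_sqrt x : 0 < x <= 1 ->
  (newton_sqrt n).[x] @[n --> \oo] --> Num.sqrt x.
Proof.
move=> /andP[x0 x1]; set r := Num.sqrt x.
have x01 : 0 <= x <= 1 by rewrite ltW.
have r0 : 0 < r by rewrite sqrtr_gt0.
have r1 : r <= 1 by rewrite -[leRHS]sqrtr1 ler_sqrt.
apply: (@squeeze_cvgr _ _ _ _ (fun n => r - r * (1 - r / 2) ^+ n) (cst r)).
- apply: nearW => n; have [/andP[_ ->] yr] := newton_sqrt_bounds n x01.
  by rewrite andbT; move: yr; rewrite -/r; lra.
- rewrite -[X in _ --> X]subr0 -[X in _ --> _ - X](mulr0 r); apply: cvgB.
    exact: cvg_cst.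
  apply: cvgMr; apply: cvg_expr.
  by rewrite ger0_norm; lra.
- exact: cvg_cst.
Qed.

(** The polynomials are products of the step approximation and the square-root iterates; both
    factors lie in [0, 1], which yields the uniform bound. *)
Lemma poly_cvg_indicator_sqrt t : 0 < t <= 1 ->
  exists p : nat -> {poly R}, forall x, 0 < x <= 1 ->
    (forall n, `|(p n).[x]| <= 1) /\
    (p n).[x] @[n --> \oo] --> (x < t)%R%:R * Num.sqrt x.
Proof.
move=> t01.
exists (fun n => (1 - 'X^n) ^+ Num.truncn (n%:R / t ^+ n) * newton_sqrt n) => x x01.
have x01' : 0 <= x <= 1 by case/andP: x01 => /ltW -> ->.
have pE n : ((1 - 'X^n) ^+ Num.truncn (n%:R / t ^+ n) * newton_sqrt n).[x] =
    (1 - x ^+ n) ^+ Num.truncn (n%:R / t ^+ n) * (newton_sqrt n).[x].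
  by rewrite hornerM horner_exp !hornerE.
split=> [n|].
  have [/andP[y0 yr] _] := newton_sqrt_bounds n x01'.
  have /andP[xn0 xn1] : 0 <= x ^+ n <= 1.
    by case/andP: x01' => x0 x1; rewrite exprn_ge0//= exprn_ile1.
  have r1 : Num.sqrt x <= 1.
    by case/andP: x01 => x0 x1; rewrite -[leRHS]sqrtr1 ler_sqrt.
  rewrite pE normrM !ger0_norm ?exprn_ge0//; last by lra.
  rewrite mulr_ile1 ?exprn_ge0 ?exprn_ile1//; lra.
under eq_fun do rewrite pE.
by apply: cvgM; [exact: cvg_step|exact: cvg_newton_sqrt].
Qed.

End step_approximation.

(** * From equal power means to equal measures of superlevel sets *)

Section uniqueness.
Context {R : realType}.
Local Notation mu := (@lebesgue_measure R).
Local Notation I01 := (`[0, 1]%classic : set R).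
Variables q1 q2 : R -> R.
Hypotheses (mq1 : measurable_fun I01 q1) (mq2 : measurable_fun I01 q2).
Hypotheses (bq1 : bounded1 q1) (bq2 : bounded1 q2).

(** Equality on an open interval gives equal derivatives; in the formula for the derivative the
    factor [p / c] is nonzero and can be cancelled. *)
Lemma power_mean_eqB1 (p a b : R) : p != 0 -> 0 <= a -> b <= 1 ->
  {in `]a, b[, power_mean p q1 =1 power_mean p q2} ->
  {in `]a, b[, power_mean (p - 1) q1 =1 power_mean (p - 1) q2}.
Proof.
move=> p0 a0 b1 eqp c cab.
have c01 : 0 < c < 1.
  by move: cab; rewrite in_itv/= => /andP[ac cb];
    rewrite (le_lt_trans a0)//= (lt_le_trans cb).
have d1 := is_derive_power_mean mq1 bq1 p c01.
have d2 := is_derive_power_mean mq2 bq2 p c01.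
have near12 : \near c, power_mean p q1 c = power_mean p q2 c.
  by apply: filterS (near_in_itvoo cab) => x; exact: eqp.
have d3 := near_eq_is_derive near12 d1.
have := @derive_val _ _ _ _ _ _ _ d3; rewrite (@derive_val _ _ _ _ _ _ _ d2).
have : p / c != 0 by rewrite mulf_neq0// invr_neq0// gt_eqF//; case/andP: c01.
have -> := eqp _ cab.
move: (p / c) (power_mean p q2 c) (power_mean (p - 1) q1 c) (power_mean (p - 1) q2 c).
by move=> k A B1 B2 k0 /(mulfI k0)/addrI/oppr_inj.
Qed.

(** As [p] is not a natural number, the descending exponents never reach 0, where the descent would
    stop. *)
Lemma power_mean_eqBn (p a b : R) n : (forall k, p != k%:R) -> 0 <= a -> b <= 1 ->
  {in `]a, b[, power_mean p q1 =1 power_mean p q2} ->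
  {in `]a, b[, power_mean (p - n%:R) q1 =1 power_mean (p - n%:R) q2}.
Proof.
move=> pN a0 b1 eqp; elim: n => [|n IH]; first by rewrite subr0.
rewrite -natr1 opprD addrA; apply: power_mean_eqB1 => //.
by rewrite subr_eq0.
Qed.

Variable c : R.
Hypothesis c01 : 0 < c < 1.
Hypothesis eq12 : forall n, power_mean (2^-1 - n%:R) q1 c = power_mean (2^-1 - n%:R) q2 c.

(* With [x := (1 - c) / w] in (0, 1], the power means of exponents [1/2 - n] are
   the moments of [x] for the measure [sqrt w ds]; since [sqrt x * sqrt w] is
   constant, approximating [1_(x < t) sqrt x] by polynomials removes the weight. *)
Let w (q : R -> R) s := 1 + c * q s.
Let x q s := (1 - c) / w q s.

Let wP (q : R -> R) s : bounded1 q -> I01 s -> 1 - c <= w q s <= 2.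
Proof.
case/andP: c01 => c0 c1 bq Is; have := bq _ Is.
by rewrite ler_norml => /andP[? ?]; apply/andP; split; rewrite /w; nra.
Qed.

Let w_gt0 (q : R -> R) s : bounded1 q -> I01 s -> 0 < w q s.
Proof.
move=> bq Is; have /andP[+ _] := wP bq Is; apply: lt_le_trans.
by case/andP: c01; lra.
Qed.

Let x01 (q : R -> R) s : bounded1 q -> I01 s -> 0 < x q s <= 1.
Proof.
move=> bq Is; have w0 := w_gt0 bq Is.
rewrite /x divr_gt0//=; last by case/andP: c01; lra.
by rewrite ler_pdivrMr// mul1r; case/andP: (wP bq Is).
Qed.

Let x_powR (q : R -> R) s : bounded1 q -> I01 s -> x q s = (1 - c) * w q s `^ (- 1).
Proof. by move=> bq Is; rewrite powR_inv1// ltW// w_gt0. Qed.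

Let mx (q : R -> R) : bounded1 q -> measurable_fun I01 q -> measurable_fun I01 (x q).
Proof.
move=> bq mq.
apply: (@eq_measurable_fun _ _ _ _ _ (fun s => (1 - c) * w q s `^ (- 1))).
  by move=> s /set_mem Is; rewrite x_powR.
by apply: measurable_funM => //; exact: measurable_affine_powR.
Qed.

Let mpoly (q : R -> R) (p : {poly R}) : bounded1 q -> measurable_fun I01 q ->
  measurable_fun I01 (fun s => p.[x q s] * w q s `^ 2^-1).
Proof.
move=> bq mq; apply: measurable_funM; last exact: measurable_affine_powR.
apply: measurableT_comp (mx bq mq).
by apply: continuous_measurable_fun => r; exact: continuous_horner.
Qed.

Let Xn_powR (q : R -> R) n s : bounded1 q -> I01 s ->
  x q s ^+ n * w q s `^ 2^-1 = (1 - c) ^+ n * w q s `^ (2^-1 - n%:R).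
Proof.
move=> bq Is; have w0 := w_gt0 bq Is.
rewrite powRD; last by rewrite (gt_eqF w0) implybT.
by rewrite powR_invn ?ltW// /x expr_div_n -!mulrA [w q s `^ _ * _]mulrC.
Qed.

Let Xn_moment (q : R -> R) n : bounded1 q -> measurable_fun I01 q ->
  mu.-integrable I01 (EFin \o (fun s => x q s ^+ n * w q s `^ 2^-1)) /\
  \int[mu]_(s in I01) (x q s ^+ n * w q s `^ 2^-1) =
  (1 - c) ^+ n * power_mean (2^-1 - n%:R) q c.
Proof.
move=> bq mq; have iw := integrable_affine_powR mq bq (2^-1 - n%:R) c01.
split.
  apply: eq_integrable (integrable_EFinZl ((1 - c) ^+ n) _ iw) => //.
  by move=> s /set_mem Is; rewrite /= Xn_powR.
rewrite -RintegralZl; [|by []|exact: iw].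
apply: eq_Rintegral => s /set_mem Is.
exact: Xn_powR.
Qed.

Let poly_moment (q : R -> R) (p : {poly R}) : bounded1 q -> measurable_fun I01 q ->
  \int[mu]_(s in I01) (p.[x q s] * w q s `^ 2^-1) =
  \sum_(0 <= n < size p) p`_n * ((1 - c) ^+ n * power_mean (2^-1 - n%:R) q c).
Proof.
move=> bq mq.
transitivity (\int[mu]_(s in I01)
    (\sum_(0 <= n < size p) p`_n * (x q s ^+ n * w q s `^ 2^-1))).
  apply: eq_Rintegral => s _; rewrite horner_coef mulr_suml big_mkord.
  by apply: eq_bigr => i _; rewrite mulrA.
rewrite Rintegral_sum//; last first.
  by move=> k; apply: integrable_EFinZl => //; have [] := Xn_moment k bq mq.
apply: eq_bigr => k _; have [ik <-] := Xn_moment k bq mq.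
by rewrite RintegralZl.
Qed.

(** Polynomial moments of [q1] and [q2] agree; by dominated convergence they tend to a common
    nonzero multiple of the measures of the sets [{q > y}]. *)
Lemma superlevel_eq (y : R) : -1 <= y < 1 ->
  [/\ mu.-integrable I01 (EFin \o (fun s => (y < q1 s)%R%:R : R)),
      mu.-integrable I01 (EFin \o (fun s => (y < q2 s)%R%:R : R)) &
      \int[mu]_(s in I01) (y < q1 s)%R%:R = \int[mu]_(s in I01) (y < q2 s)%R%:R :> R].
Proof.
move=> /andP[y1 y2]; have /andP[c0 c1] := c01.
(* The threshold for which [x < t] means [y < q]; the bound [-1 <= y] gives [t <= 1]. *)
pose t := (1 - c) / (1 + c * y).
have d0 : 0 < 1 + c * y by nra.
have t01 : 0 < t <= 1.
  rewrite /t divr_gt0//=; last by lra.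
  by rewrite ler_pdivrMr// mul1r; nra.
have [p pP] := poly_cvg_indicator_sqrt t01.
(* The constant value of [sqrt x * sqrt w]. *)
pose k := (1 - c) `^ 2^-1.
have k0 : k != 0 by rewrite /k gt_eqF// powR_gt0//; lra.
have lim (q : R -> R) : bounded1 q -> measurable_fun I01 q ->
    mu.-integrable I01 (EFin \o (fun s => (y < q s)%R%:R : R)) /\
    \int[mu]_(s in I01) ((p n).[x q s] * w q s `^ 2^-1) @[n --> \oo] -->
    k * \int[mu]_(s in I01) (y < q s)%R%:R.
  move=> bq mq.
  have [|||||il cl] := @Rdominated_convergence _ _ R mu I01
    (fun n s => (p n).[x q s] * w q s `^ 2^-1)
    (fun s => k * (y < q s)%R%:R) (cst (2 `^ 2^-1)).
  - by [].
  - by move=> n; exact: mpoly.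
  - move=> s Is; have [_ ] := pP _ (x01 bq Is).
    have w0 := w_gt0 bq Is.
    have -> : k * (y < q s)%R%:R = (x q s < t)%R%:R * Num.sqrt (x q s) * w q s `^ 2^-1.
      have x0 : 0 < x q s by case/andP: (x01 bq Is).
      have -> : (x q s < t) = (y < q s).
        rewrite /x /t ltr_pM2l; last by lra.
        by rewrite ltf_pV2 ?posrE// /w ltrD2l ltr_pM2l.
      rewrite -powR12_sqrt; last exact: ltW.
      rewrite -mulrA -powRM ?ltW// /x divfK; last by rewrite gt_eqF.
      by rewrite mulrC.
    by move=> h; apply: cvgM => //; exact: cvg_cst.
  - by apply: (@integrable01 _ _ (2 `^ 2^-1)) => // s _; rewrite /= ger0_norm// powR_ge0.
  - move=> n s Is; rewrite normrM -[leRHS]mul1r ler_pM//.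
      by have [] := pP _ (x01 bq Is).
    rewrite ger0_norm ?powR_ge0//; have w0 := w_gt0 bq Is.
    have /andP[_ w2] := wP bq Is.
    by apply: ge0_ler_powR; rewrite ?nnegrE ?invr_ge0 ?(ltW w0).
  have ii : mu.-integrable I01 (EFin \o (fun s => (y < q s)%R%:R : R)).
    apply: eq_integrable (integrable_EFinZl k^-1 _ il) => //.
    by move=> s _; rewrite /= mulKf.
  by split=> //; rewrite -RintegralZl.
have [ii1 l1] := lim _ bq1 mq1; have [ii2 l2] := lim _ bq2 mq2.
split=> //.
have e n : \int[mu]_(s in I01) ((p n).[x q1 s] * w q1 s `^ 2^-1) =
           \int[mu]_(s in I01) ((p n).[x q2 s] * w q2 s `^ 2^-1).
  rewrite (poly_moment _ bq1 mq1) (poly_moment _ bq2 mq2); apply: eq_bigr => i _.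
  by rewrite eq12.
move: l1; under eq_fun do rewrite e; move=> l1.
apply: (mulfI k0); exact: cvg_unique l1 l2.
Qed.

End uniqueness.

(** * Comparison of increasing functions through superlevel sets *)

Section equal_profiles.
Context {R : realType}.
Local Notation mu := (@lebesgue_measure R).
Local Notation I01 := (`[0, 1]%classic : set R).

(** If [q2 s0 < q1 s0], take [y] halfway. Monotonicity puts [{q2 > y}] inside [{q1 > y}], and
    continuity puts an interval near [s0] in the difference, so the measures cannot agree. *)
Lemma increasing_le_of_superlevel (q1 q2 : R -> R) :
  {within I01, continuous q1} -> {within I01, continuous q2} ->
  {in `[0, 1] &, {homo q1 : s t / s < t}} ->
  {in `[0, 1] &, {homo q2 : s t / s < t}} ->
  bounded1 q1 -> bounded1 q2 ->
  (forall y : R, -1 <= y < 1 ->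
    [/\ mu.-integrable I01 (EFin \o (fun s => (y < q1 s)%R%:R : R)),
      mu.-integrable I01 (EFin \o (fun s => (y < q2 s)%R%:R : R)) &
      \int[mu]_(s in I01) (y < q1 s)%R%:R = \int[mu]_(s in I01) (y < q2 s)%R%:R :> R]) ->
  {in `[0, 1], forall s, q1 s <= q2 s}.
Proof.
move=> c1 c2 i1 i2 b1 b2 eq12 s0 s0I; rewrite leNgt; apply/negP => q21.
pose y := (q1 s0 + q2 s0) / 2.
have yq1 : y < q1 s0 by rewrite /y; lra.
have q2y : q2 s0 < y by rewrite /y; lra.
have yI : -1 <= y < 1.
  have := b1 _ s0I; have := b2 _ s0I; rewrite !ler_norml => /andP[? ?] /andP[? ?].
  by apply/andP; split; lra.
have [ii1 ii2 eqy] := eq12 y yI.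
have n1 : \forall s \near s0, I01 s -> y < q1 s.
  have /subspace_continuousP/(_ s0 s0I) h := c1.
  exact: (cvgr_gt _ h).
have n2 : \forall s \near s0, I01 s -> q2 s < y.
  have /subspace_continuousP/(_ s0 s0I) h := c2.
  exact: (cvgr_lt _ h).
have [d /= d0 dP] : exists2 d : R, 0 < d & forall s, `|s0 - s| < d -> I01 s ->
    q2 s < y < q1 s.
  have /nbhs_ballP[d /= d0 dP] : \forall s \near s0, I01 s -> q2 s < y < q1 s.
    by apply: filterS2 n1 n2 => s h1 h2 Is; rewrite (h1 Is) (h2 Is).
  by exists d.
(* The interval is clipped to [0, 1], since [s0] may be an endpoint; it keeps positive length. *)
pose a := Num.max 0 (s0 - d); pose b := Num.min 1 (s0 + d).
have ab : a < b.
  move: s0I; rewrite in_itv/= => /andP[s00 s01].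
  by rewrite /a /b gt_max !lt_min; apply/andP; split; apply/andP; split; lra.
have abI s : s \in `]a, b[ -> I01 s /\ `|s0 - s| < d.
  rewrite in_itv/= /a /b gt_max lt_min => /andP[/andP[? ?] /andP[? ?]].
  rewrite ltr_distlC; split; last by apply/andP; split; lra.
  by rewrite /= in_itv/=; apply/andP; split; lra.
have iab : mu.-integrable I01 (EFin \o (\1_(`]a, b[%classic : set R) : R -> R)).
  apply: (@integrable01 _ _ 1); first exact: measurable_indic.
  by move=> s _; rewrite indicE; case: (_ \in _); rewrite ?normr1 ?normr0.
have : \int[mu]_(s in I01) ((y < q2 s)%R%:R + \1_(`]a, b[%classic : set R) s) <=
    \int[mu]_(s in I01) (y < q1 s)%R%:R.
  apply: le_Rintegral => //.
    by apply: eq_integrable (integrableD _ ii2 iab).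
  move=> s Is; rewrite indicE.
  have [/set_mem/abI[_ sd]|sab] := boolP (s \in _).
    have /andP[q2s ->] := dP _ sd Is.
    by rewrite ltNge (ltW q2s) add0r.
  (* Off the interval, [q2 s > y > q2 s0] forces [s > s0], hence [q1 s > q1 s0 > y]. *)
  rewrite addr0 ler_nat; case: ltP => // yq2; rewrite lt0b.
  apply: (lt_trans yq1); apply: i1 => //.
  rewrite ltNge; apply/negP; rewrite le_eqVlt => /predU1P[ss0|ss0].
    by move: yq2; rewrite ss0 ltNge (ltW q2y).
  by have := i2 _ _ Is s0I ss0; rewrite ltNge (le_trans (ltW q2y) (ltW yq2)).
rewrite RintegralD// eqy gerDl leNgt => /negP; apply.
rewrite /Rintegral integral_indic// setIidl; last first.
  by move=> s /abI[].
by rewrite /= lebesgue_measure_itv/= lte_fin ab /= subr_gt0.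
Qed.

End equal_profiles.

(** * Bessel and binomial series *)

Section bessel_series.
Context {R : realType}.
Implicit Types (x y r : R) (n k : nat).

Definition bessel_coeff k : R := (-1) ^+ k / (k`!%:R ^+ 2 * 4 ^+ k).

Definition bessel_sum n x : R := \sum_(0 <= k < n) bessel_coeff k * x ^+ k.*2.

(** Partial sums of the series of [(1 + x)^(-1/2)]: the coefficient [(-1)^k (2k)! / (k!^2 4^k)] is
    the binomial coefficient of -1/2 over k. The factor [(2k)!] is the one produced by the Laplace
    transform of [s^(2k)]. *)
Definition binomial_sum n x : R :=
  \sum_(0 <= k < n) bessel_coeff k * (k.*2)`!%:R * x ^+ k.

Lemma norm_bessel_coeff k : `|bessel_coeff k| = (k`!%:R ^+ 2 * 4 ^+ k)^-1.
Proof.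
by rewrite normrM normrX normrN1 expr1n mul1r ger0_norm// invr_ge0.
Qed.

Lemma expr_half_double x k : (x / 2) ^+ k.*2 = x ^+ k.*2 / 4 ^+ k.
Proof.
rewrite expr_div_n; suff -> : (2 : R) ^+ k.*2 = 4 ^+ k by [].
by rewrite -muln2 mulnC exprM -natrX.
Qed.

Lemma sum_sqr_le (u : nat -> R) n : (forall k, 0 <= u k) ->
  \sum_(0 <= k < n) u k ^+ 2 <= (\sum_(0 <= k < n) u k) ^+ 2.
Proof.
move=> u0; elim: n => [|n IH]; first by rewrite !big_geq// expr0n.
rewrite !big_nat_recr//= sqrrD.
have : 0 <= \sum_(0 <= k < n) u k by apply: sumr_ge0.
by have := u0 n; move: IH; set S := \sum_(_ <= _ < _) _; set T := \sum_(_ <= _ < _) _; nra.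
Qed.

(* [sum u_k^2 <= (sum u_k)^2] with [u_k = (x/2)^k / k!] *)
Lemma bessel_abs_sum_le n x : 0 <= x ->
  \sum_(0 <= k < n) `|bessel_coeff k| * x ^+ k.*2 <= expR x.
Proof.
move=> x0; have x20 : 0 <= x / 2 by rewrite divr_ge0.
pose u k := exp_coeff (x / 2) k.
have u0 k : 0 <= u k by rewrite /u exp_coeff_ge0.
have uE : \sum_(0 <= k < n) `|bessel_coeff k| * x ^+ k.*2 = \sum_(0 <= k < n) u k ^+ 2.
  apply: eq_bigr => k _; rewrite norm_bessel_coeff /u /exp_coeff /=.
  rewrite [RHS]expr_div_n -exprM muln2 expr_half_double invfM.
  by rewrite mulrC [_ ^- 2 * _]mulrC mulrA.
rewrite uE (le_trans (sum_sqr_le _ u0))//.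
have -> : expR x = expR (x / 2) ^+ 2 by rewrite expr2 -expRD -splitr.
rewrite lerXn2r ?nnegrE ?expR_ge0 ?sumr_ge0//.
rewrite /expR; apply: (nondecreasing_cvgn_le _ (is_cvg_series_exp_coeff _)).
by apply: nondecreasing_series => k _ _; exact: u0.
Qed.

Lemma norm_bessel_sum_le n x : 0 <= x -> `|bessel_sum n x| <= expR x.
Proof.
move=> x0; apply: le_trans (bessel_abs_sum_le n x0).
rewrite (le_trans (ler_norm_sum _ _ _))//; apply: ler_sum => k _.
by rewrite normrM (ger0_norm (exprn_ge0 _ x0)).
Qed.

(** The partial sums of absolute values increase and are bounded by [expR x], so the series
    converges absolutely. *)
Lemma cvg_bessel_sum x : 0 <= x -> bessel_sum n x @[n --> \oo] --> besselJ0 x.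
Proof.
move=> x0; rewrite /besselJ0; set f := (X in limn (series X)).
have fE k : f k = bessel_coeff k * x ^+ k.*2.
  rewrite /f expr_half_double /bessel_coeff.
  move: (_ ^+ 2) (4 ^+ k) (x ^+ _) (_ ^+ k) => F P X s.
  by rewrite invfM !mulrA [RHS]mulrAC.
have -> : (fun n => bessel_sum n x) = series f.
  by apply/funext => n; apply: eq_bigr => k _; rewrite fE.
suff : cvgn (series f) by [].
apply: normed_cvg; apply: nondecreasing_is_cvgn.
  by apply: (@nondecreasing_series _ (fun k => `|f k|) xpredT) => k _ _.
exists (expR x) => _ [n _ <-]; apply: le_trans (bessel_abs_sum_le n x0).
rewrite /normed_series_of /series /=.
by apply: ler_sum => k _; rewrite fE normrM (ger0_norm (exprn_ge0 _ x0)).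
Qed.

(** The recurrence of the binomial coefficients of exponent -1/2. *)
Lemma bessel_coeffS k : k.+1%:R * (bessel_coeff k.+1 * (k.+1.*2)`!%:R) =
  - (k%:R + 2^-1) * (bessel_coeff k * (k.*2)`!%:R) :> R.
Proof.
have f0 : (k`!%:R : R) != 0 by rewrite pnatr_eq0 -lt0n fact_gt0.
have k0 : (k%:R + 1 : R) != 0 by rewrite natr1 pnatr_eq0.
have p0 : (4 ^+ k : R) != 0 by rewrite expf_neq0// pnatr_eq0.
have e1 : k.+1`!%:R = (k%:R + 1) * k`!%:R :> R by rewrite factS natrM natr1.
have e2 : (k.+1.*2)`!%:R = (2 * k%:R + 2) * ((2 * k%:R + 1) * (k.*2)`!%:R) :> R.
  have e : (k.*2)%:R = 2 * k%:R :> R by rewrite -muln2 natrM mulrC.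
  rewrite doubleS !factS !natrM -[k.*2.+2%:R]natr1 -[k.*2.+1%:R]natr1 e.
  by congr (_ * _); ring.
rewrite /bessel_coeff e1 e2 !exprS -natr1; move: f0 k0 p0.
move: (k`!%:R) (k%:R) (4 ^+ k) ((-1) ^+ k) ((k.*2)`!%:R) => F K P s G F0 K0 P0.
by rewrite expr0; field; rewrite F0 K0 P0.
Qed.

Lemma norm_binomial_coeff k : `|bessel_coeff k * (k.*2)`!%:R| <= 1 :> R.
Proof.
elim: k => [|k IH].
  by rewrite /bessel_coeff !expr0 fact0 expr1n mulr1 divr1 mulr1 normr1.
have k0 : (0 : R) < k.+1%:R by [].
have := congr1 Num.norm (bessel_coeffS k).
rewrite normrM [RHS]normrM (ger0_norm (ltW k0)) normrN => e.
rewrite -(ler_pM2l k0) mulr1 e -[leRHS]mulr1 ler_pM//.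
rewrite ger0_norm; last by rewrite addr_ge0.
by rewrite -[leRHS]natr1; lra.
Qed.

Lemma is_derive_binomial_sum n x :
  is_derive x 1 (binomial_sum n) (\sum_(0 <= k < n) bessel_coeff k * (k.*2)`!%:R * (k%:R * x ^+ k.-1)).
Proof.
elim: n => [|n IH].
  rewrite big_geq//; have -> : binomial_sum 0 = cst 0 by apply/funext => y; rewrite /binomial_sum big_geq.
  exact: is_derive_cst.
rewrite big_nat_recr//=.
have -> : binomial_sum n.+1 = binomial_sum n + (fun x => bessel_coeff n * (n.*2)`!%:R * x ^+ n).
  by apply/funext => y; rewrite /binomial_sum big_nat_recr.
apply: is_deriveD; have dX : is_derive x 1 (fun y : R => y ^+ n) (n%:R * x ^+ n.-1).
  by apply: DeriveDef; [exact: exprn_derivable|rewrite exp_derive /GRing.scale/= mulr1].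
exact: (is_deriveZ (bessel_coeff n * (n.*2)`!%:R) dX).
Qed.

(* Partial-sum form of the equation [(1 + x) f' + f / 2 = 0] of [(1 + x)^(-1/2)]. *)
Lemma binomial_sum_ode n x :
  (1 + x) * \sum_(0 <= k < n) bessel_coeff k * (k.*2)`!%:R * (k%:R * x ^+ k.-1)
    + binomial_sum n x / 2
  = - (n%:R * (bessel_coeff n * (n.*2)`!%:R) * x ^+ n.-1).
Proof.
elim: n => [|n IH].
  by rewrite /binomial_sum !big_geq// mulr0 mul0r addr0 !mul0r oppr0.
rewrite bessel_coeffS big_nat_recr//=.
have -> : binomial_sum n.+1 x = binomial_sum n x + bessel_coeff n * (n.*2)`!%:R * x ^+ n.
  by rewrite /binomial_sum big_nat_recr.
move: IH; move: (binomial_sum n x) (bessel_coeff n * (n.*2)`!%:R) => S A.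
set D := \sum_(_ <= _ < _) _ => IH.
transitivity ((1 + x) * D + S / 2 + (1 + x) * (A * (n%:R * x ^+ n.-1)) + A * x ^+ n / 2).
  by ring.
rewrite IH; case: n {IH D} => [|n]; first by rewrite !expr0; field.
by rewrite /= exprS; field.
Qed.

(** Multiplication by the integrating factor [(1 + x)^(1/2)] makes the derivative collapse to the
    single remainder term of the differential equation. *)
Lemma is_derive_sqrt_binomial_sum n x : 0 <= x ->
  is_derive x 1 (fun y => (1 + y) `^ 2^-1 * binomial_sum n y)
    (- ((1 + x) `^ (2^-1 - 1) * (n%:R * (bessel_coeff n * (n.*2)`!%:R) * x ^+ n.-1))).
Proof.
move=> x0; have x1 : 0 < 1 + x by lra.
have d1 : is_derive x 1 (fun y : R => 1 + y) 1.
  by have := is_deriveD (is_derive_cst (1 : R) x (1 : R)) (is_derive_id x (1 : R));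
    rewrite add0r.
have d2 := @is_derive1_comp R (fun a => a `^ 2^-1) (fun y => 1 + y) x _ _
  (is_derive1_powR 2^-1 x1) d1.
have d3 := is_deriveM d2 (is_derive_binomial_sum n x).
apply: (is_derive_eq d3).
rewrite -mulrN -binomial_sum_ode /GRing.scale/= mulr1.
have -> : (1 + x) `^ 2^-1 = (1 + x) `^ (2^-1 - 1) * (1 + x).
  rewrite -[X in _ = _ * X](powRr1 (ltW x1)) -powRD ?subrK//.
  by rewrite (gt_eqF x1) implybT.
by ring.
Qed.

(** The product equals 1 at 0; the mean value theorem bounds its variation, as [(1 + c)^(-1/2)] and
    the coefficient are at most 1 in absolute value. *)
Lemma binomial_sum_error n x : 0 <= x < 1 ->
  `|(1 + x) `^ 2^-1 * binomial_sum n.+1 x - 1| <= n.+1%:R * x ^+ n.+1.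
Proof.
move=> /andP[x0 x1].
have df y : y \in `]0, x[ -> _ := fun yI =>
  @is_derive_sqrt_binomial_sum n.+1 y (ltac:(by move: yI; rewrite in_itv/= => /andP[/ltW])).
have cf : {within `[0, x], continuous (fun y => (1 + y) `^ 2^-1 * binomial_sum n.+1 y)}.
  apply: derivable_within_continuous => y; rewrite in_itv/= => /andP[y0 _].
  by have [] := is_derive_sqrt_binomial_sum n.+1 y0.
(* The index [n.+1] matters: the empty sum would be 0. Only the term [k = 0] survives, with
   [0^0 = 1]. *)
have S0 : binomial_sum n.+1 0 = 1.
  rewrite /binomial_sum big_nat_recl//= big1_seq ?addr0 => [|i _].
    by rewrite /bessel_coeff !expr0 fact0 expr1n !mulr1 invr1 !mulr1.
  by rewrite expr0n mulr0.
have [c] := MVT_segment x0 df cf.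
rewrite S0 addr0 powR1 mulr1 in_itv/= => /andP[c0 cx] ->.
have c1 : (1 + c) `^ (2^-1 - 1) <= 1.
  rewrite -[leRHS](powRr0 (1 + c)) ler_powR//; first by rewrite lerDl.
  by lra.
have cxn : c ^+ n <= x ^+ n by rewrite lerXn2r// nnegrE.
have P0 := powR_ge0 (1 + c) (2^-1 - 1).
move: (norm_binomial_coeff n.+1) => /=; move: (bessel_coeff _ * _) => A A1.
rewrite subr0 mulNr normrN.
have -> : (1 + c) `^ (2^-1 - 1) * (n.+1%:R * A * c ^+ n) * x =
    (1 + c) `^ (2^-1 - 1) * A * c ^+ n * (n.+1%:R * x) by ring.
have -> : n.+1%:R * x ^+ n.+1 = x ^+ n * (n.+1%:R * x) by rewrite exprS; ring.
rewrite normrM (ger0_norm (mulr_ge0 _ x0))// ler_wpM2r ?mulr_ge0//.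
rewrite -[leRHS]mul1r normrM (ger0_norm (exprn_ge0 _ c0)) ler_pM ?exprn_ge0//.
by rewrite normrM (ger0_norm P0) mulr_ile1.
Qed.

Lemma cvg_binomial_sum x : 0 <= x < 1 ->
  binomial_sum n x @[n --> \oo] --> (1 + x) `^ (- 2^-1).
Proof.
move=> /andP[x0 x1].
have p0 : 0 < (1 + x) `^ 2^-1 by rewrite powR_gt0//; lra.
have x01 : 0 <= x < 1 by apply/andP.
suff h : (1 + x) `^ 2^-1 * binomial_sum n.+1 x @[n --> \oo] --> (1 : R).
  rewrite -cvg_shiftS powRN.
  have -> : (fun n => binomial_sum n.+1 x) =
    (fun n => ((1 + x) `^ 2^-1)^-1 * ((1 + x) `^ 2^-1 * binomial_sum n.+1 x)).
    by apply/funext => n; rewrite mulKf// gt_eqF.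
  by have := cvgM (@cvg_cst _ ((1 + x) `^ 2^-1)^-1 _ _ _) h; rewrite mulr1; apply.
have e0 : n.+1%:R * x ^+ n.+1 @[n --> \oo] --> (0 : R).
  rewrite (cvg_shiftS (fun n => n%:R * x ^+ n)).
  have [->|xN0] := eqVneq x 0.
    apply: cvg_near_cst; exists 1%N => // n /= n0.
    by rewrite expr0n -[n == 0%N]negbK -lt0n n0 mulr0.
  by apply: cvg_natM_expr; rewrite lt0r xN0 x0.
apply: cvg_zero; apply: norm_cvg0; apply: squeeze_cvgr e0; last exact: cvg_cst.
by apply: nearW => n; rewrite normr_ge0 /= binomial_sum_error.
Qed.

(** Comparison with the geometric series of ratio [r]; the bound is uniform in [n] and [x], as
    domination requires. *)
Lemma norm_binomial_sum_le n x r : 0 <= x <= r -> r < 1 ->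
  `|binomial_sum n x| <= (1 - r)^-1.
Proof.
move=> /andP[x0 xr] r1; have r0 := le_trans x0 xr.
apply: (@le_trans _ _ (\sum_(0 <= k < n) r ^+ k)).
  rewrite (le_trans (ler_norm_sum _ _ _))//; apply: ler_sum => k _.
  rewrite normrM -[leRHS]mul1r ler_pM ?norm_binomial_coeff//.
  by rewrite ger0_norm ?exprn_ge0// lerXn2r// nnegrE.
have r10 : 0 < 1 - r by lra.
rewrite -[leRHS]mul1r ler_pdivlMr//.
have -> : (\sum_(0 <= k < n) r ^+ k) * (1 - r) = 1 - r ^+ n.
  elim: n => [|n IH]; first by rewrite big_geq// mul0r expr0 subrr.
  by rewrite big_nat_recr//= mulrDl IH exprSr; ring.
by rewrite gerBl exprn_ge0.
Qed.

End bessel_series.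

(** * Laplace transforms of monomials *)

Section laplace_monomial.
Context {R : realType}.
Local Notation mu := (@lebesgue_measure R).
Implicit Types (s sigma : R) (n : nat).

Lemma cvg_expR_monomial sigma n : 0 < sigma ->
  expR (- (sigma * s)) * s ^+ n @[s --> +oo] --> (0 : R).
Proof.
(* The term of degree [n + 1] of the exponential series gives [exp(- sigma s) s^n <= C / s]. *)
move=> s0; pose C := (n.+1)`!%:R / sigma ^+ n.+1.
apply: (@squeeze_cvgr _ _ _ _ (cst 0) (fun s => C * s^-1)).
- near=> s; have sp : 0 < s by near: s; exact: nbhs_pinfty_gt.
  apply/andP; split; first by rewrite mulr_ge0 ?expR_ge0 ?exprn_ge0 ?ltW.
  rewrite expRN ler_pdivrMl ?expR_gt0//.
  have e : (sigma * s) ^+ n.+1 / (n.+1)`!%:R <= expR (sigma * s).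
    by apply: le_trans (expR_ge1Dxn n _); [rewrite lerDr|rewrite mulr_ge0// ltW].
  have -> : s ^+ n = (sigma * s) ^+ n.+1 / (n.+1)`!%:R * (C / s).
    have sn0 : sigma ^+ n.+1 != 0 by rewrite gt_eqF ?exprn_gt0.
    have fn0 : (n.+1)`!%:R != 0 :> R by rewrite pnatr_eq0 -lt0n fact_gt0.
    rewrite /C exprMn [s ^+ n.+1]exprSr.
    move: sn0 fn0; move: (sigma ^+ _) (_%:R) (s ^+ n) => P F X P0 F0.
    by field; rewrite P0 F0 gt_eqF.
  rewrite ler_wpM2r// divr_ge0 ?ltW// divr_gt0 ?exprn_gt0//.
- exact: cvg_cst.
- rewrite -(mulr0 C); apply: cvgMr.
  apply/cvgrPdist_le => e e0; near=> s.
  have es : e^-1 <= s by near: s; apply: nbhs_pinfty_ge; exact: num_real.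
  have sp : 0 < s by apply: lt_le_trans es; rewrite invr_gt0.
  rewrite sub0r normrN ger0_norm ?invr_ge0 ?(ltW sp)//.
  by rewrite -[leRHS]invrK lef_pV2// posrE invr_gt0.
Unshelve. all: by end_near. Qed.

(** The antiderivative of [exp(- sigma s) s^n] that vanishes at infinity, obtained by repeated
    integration by parts. *)
Fixpoint laplace_primitive sigma n s : R :=
  if n is n'.+1 then
    n'.+1%:R / sigma * laplace_primitive sigma n' s - expR (- (sigma * s)) * s ^+ n / sigma
  else - (expR (- (sigma * s)) / sigma).

Lemma laplace_primitive0 sigma n : 0 < sigma ->
  laplace_primitive sigma n 0 = - (n`!%:R / sigma ^+ n.+1).
Proof.
move=> s0; elim: n => [|n IH] /=.
  by rewrite mulr0 oppr0 expR0 fact0 expr1.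
rewrite IH expr0n mulr0 mul0r subr0 factS natrM [sigma ^+ n.+2]exprS invfM.
by rewrite mulrN mulf_div invfM.
Qed.

Lemma cvg_laplace_primitive sigma n : 0 < sigma ->
  laplace_primitive sigma n s @[s --> +oo] --> (0 : R).
Proof.
move=> s0; elim: n => [|n IH] /=.
  rewrite -oppr0 -(mul0r sigma^-1); apply: cvgN; apply: cvgMl.
  by have := @cvg_expR_monomial sigma 0 s0; under eq_fun do rewrite expr0 mulr1.
have h1 : n.+1%:R / sigma * laplace_primitive sigma n s @[s --> +oo] -->
    n.+1%:R / sigma * 0 by exact: cvgMr.
have h2 : expR (- (sigma * s)) * s ^+ n.+1 / sigma @[s --> +oo] --> 0 / sigma.
  by apply: cvgMl; exact: cvg_expR_monomial.
suff : n.+1%:R / sigma * laplace_primitive sigma n s -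
    expR (- (sigma * s)) * s ^+ n.+1 / sigma @[s --> +oo] -->
    n.+1%:R / sigma * 0 - 0 / sigma by rewrite mulr0 mul0r subr0.
exact: cvgB.
Qed.

Lemma is_derive_laplace_primitive sigma n s : 0 < sigma ->
  is_derive s 1 (laplace_primitive sigma n) (expR (- (sigma * s)) * s ^+ n).
Proof.
move=> s0.
have dE : is_derive s 1 (fun s => expR (- (sigma * s))) (- sigma * expR (- (sigma * s))).
  have dl : is_derive s 1 (fun s => - (sigma * s)) (- sigma).
    have := is_deriveN (is_deriveZ sigma (is_derive_id s (1 : R))).
    by rewrite /GRing.scale/= mulr1.
  have := @is_derive1_comp R (@expR R) _ s _ _ (is_derive_expR _) dl.
  by rewrite mulrC.
have dk (f : R -> R) d k : is_derive s 1 f d -> is_derive s 1 (fun s => f s * k) (d * k).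
  move=> df; have := is_deriveZ k df.
  have -> : k \*: f = (fun s => f s * k) by apply/funext => y; rewrite /= mulrC.
  by rewrite /GRing.scale/= mulrC.
elim: n => [|n IH] /=.
  have := is_deriveN (dk _ _ sigma^-1 dE).
  by rewrite expr0 mulr1 mulNr mulNr opprK mulrAC mulfV ?mul1r// gt_eqF.
have dX : is_derive s 1 (fun y : R => y ^+ n.+1) (n.+1%:R * s ^+ n).
  by apply: DeriveDef; [exact: exprn_derivable|rewrite exp_derive /GRing.scale/= mulr1].
have d1 := is_deriveZ (n.+1%:R / sigma) IH.
have d2 := dk _ _ sigma^-1 (is_deriveM dE dX).
apply: (is_derive_eq (is_deriveB d1 d2)).
rewrite /GRing.scale/= exprS.
move: (expR _) (s ^+ n) => E X; field.
by rewrite gt_eqF.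
Qed.

(** The fundamental theorem of calculus on the half-line applies to the nonnegative integrand; the
    finite value also gives integrability. *)
Lemma laplace_monomial sigma n : 0 < sigma ->
  mu.-integrable `[0, +oo[ (EFin \o (fun s => expR (- (sigma * s)) * s ^+ n)) /\
  \int[mu]_(s in `[0, +oo[) (expR (- (sigma * s)) * s ^+ n) =
  n`!%:R / sigma ^+ n.+1.
Proof.
move=> s0.
pose f s : R := expR (- (sigma * s)) * s ^+ n.
have cf : continuous f.
  move=> s; apply: (@continuousM _ _ (fun s => expR (- (sigma * s))) (fun s => s ^+ n)).
    apply: (@continuous_comp _ _ _ (fun s => - (sigma * s)) expR).
      by apply: continuousN; apply: mulrl_continuous.
    exact: continuous_expR.
  exact: exprn_continuous.
have f0 s : 0 <= s -> 0 <= f s by move=> s1; rewrite mulr_ge0 ?expR_ge0 ?exprn_ge0.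
have dP s : is_derive s 1 (laplace_primitive sigma n) (f s).
  exact: is_derive_laplace_primitive.
have FTC : (\int[mu]_(s in `[0%R, +oo[) (f s)%:E =
    0%:E - (laplace_primitive sigma n 0)%:E)%E.
  apply: ge0_continuous_FTC2y => //.
  - exact: continuous_subspaceT.
  - exact: cvg_laplace_primitive.
  - apply: cvg_at_right_filter; apply: differentiable_continuous.
    by apply/derivable1_diffP; have [] := dP 0.
  - by move=> x _; rewrite derive1E; have [_ ->] := dP x.
rewrite laplace_primitive0// -EFinB opprK add0r in FTC.
have mf : measurable_fun (`[0, +oo[%classic : set R) f.
  by apply: measurable_funTS; exact: continuous_measurable_fun.
split; last by rewrite /Rintegral FTC.
apply/integrableP; split; first exact/measurable_EFinP.
under eq_integral.
  move=> x; rewrite inE/= in_itv/= andbT => x0.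
  rewrite ger0_norm; last exact: f0.
  over.
by rewrite FTC ltry.
Qed.

End laplace_monomial.

(** * The Hankel and Laplace transforms *)

Section moments_of_Q.
Context {R : realType}.
Local Notation mu := (@lebesgue_measure R).
Local Notation I01 := (`[0, 1]%classic : set R).
Local Notation R0y := (`[0, +oo[%classic : set R).

Lemma within_continuous_sqr (h : R -> R) (c d : R) : 0 <= c -> 0 <= d ->
  {within `[c, d], continuous h} ->
  {within `[Num.sqrt c, Num.sqrt d], continuous (fun t => h (t ^+ 2))}.
Proof.
move=> c0 d0 /subspace_continuousP ch; apply/subspace_continuousP => t tI.
have sqI s : `[Num.sqrt c, Num.sqrt d]%classic s -> `[c, d]%classic (s ^+ 2).
  rewrite /= !in_itv/= => /andP[cs sd].
  have s0 : 0 <= s by apply: le_trans cs; exact: sqrtr_ge0.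
  rewrite -(sqr_sqrtr c0) -(sqr_sqrtr d0) !lerXn2r ?nnegrE ?sqrtr_ge0//.
apply: (@cvg_comp _ _ _ (fun t => t ^+ 2) h _ _ _ _ (ch _ (sqI _ tI))).
move=> A; rewrite /within /= => nA.
have nA2 : \forall s \near t, `[c, d]%classic (s ^+ 2) -> A (s ^+ 2).
  exact: (@exprn_continuous R 2 t _ nA).
by apply: filterS nA2 => s h1 sI; apply: h1; exact: sqI.
Qed.

Variable q : R -> R.
Hypotheses (hq : increasing_C1_profile q) (q0_ge0 : 0 <= q 0).

Let cq : {within `[0, 1], continuous q}.
Proof. by case: hq => -[/derivable_oo_LRcontinuous_within]. Qed.

Let iq : {in `[0, 1] &, {homo q : s t / s < t}}.
Proof. by case: hq. Qed.

Let q01 : q 0 < q 1.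
Proof. by apply: iq; rewrite ?in_itv/= ?lexx ?ler01 ?ltr01. Qed.

Let inj_q : {in I01 &, injective q}.
Proof.
move=> s t /set_mem sI /set_mem tI qst; apply/eqP; rewrite eq_le !leNgt.
by apply/andP; split; apply/negP => h;
  [have := iq tI sI h|have := iq sI tI h]; rewrite qst ltxx.
Qed.

Let qinvK r : r \in `[0, 1] -> qinv q (q r) = r.
Proof. by move=> rI; rewrite /qinv pinvKV// inE. Qed.

Let q_surj y : y \in `[q 0, q 1] -> exists2 r, r \in `[0, 1] & q r = y.
Proof.
move=> yI; apply: IVT => //.
by rewrite min_l ?max_r ?(ltW q01).
Qed.

Let qinv_sub y : y \in `[q 0, q 1] -> qinv q y \in `[0, 1] /\ q (qinv q y) = y.
Proof. by move=> /q_surj[r rI <-]; rewrite qinvK. Qed.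

Let qinv_incr : {in `[q 0, q 1] &, {homo qinv q : y z / y < z}}.
Proof.
move=> y z /qinv_sub[yI ey] /qinv_sub[zI ez] yz; rewrite ltNge; apply/negP.
rewrite le_eqVlt => /predU1P[e|h]; first by move: yz; rewrite -ey -ez e ltxx.
by have := iq zI yI h; rewrite ey ez ltNge (ltW yz).
Qed.

(** Since [q 0 >= 0], squaring maps [[a, b]] increasingly onto [[q 0, q 1]], and on the half-line
    [Q] vanishes off []a, b[]. *)
Let a := Num.sqrt (q 0).
Let b := Num.sqrt (q 1).

Let q1_gt0 : 0 < q 1. Proof. exact: le_lt_trans q01. Qed.

Let ab : a < b. Proof. by rewrite ltr_sqrt. Qed.

Let a_ge0 : 0 <= a. Proof. exact: sqrtr_ge0. Qed.

Let sqr_oo t : 0 <= t -> (t ^+ 2 \in `]q 0, q 1[) = (t \in `]a, b[).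
Proof.
move=> t0; rewrite !in_itv/= -(sqr_sqrtr q0_ge0) -(sqr_sqrtr (ltW q1_gt0)).
by rewrite !ltr_pXn2r ?nnegrE ?sqrtr_ge0.
Qed.

Let Q_out t : 0 <= t -> t \notin `]a, b[ -> Q_of q t = 0.
Proof.
by move=> t0 tab; rewrite /Q_of indicE mem_setE sqr_oo// (negbTE tab) mul0r.
Qed.

Let Q_in t : t \in `]a, b[ -> Q_of q t = derive1 (qinv q) (t ^+ 2).
Proof.
move=> tab; have t0 : 0 <= t by move: tab; rewrite in_itv/= => /andP[/ltW/(le_trans a_ge0)].
by rewrite /Q_of indicE mem_setE sqr_oo// tab mul1r.
Qed.

Let g_spec : exists2 g : R -> R, {within `[q 0, q 1], continuous g} &
  {in `]q 0, q 1[, derive1 (qinv q) =1 g}.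
Proof. by case: hq => _ _ _ []. Qed.

Let qinv_cont : {within `[q 0, q 1], continuous (qinv q)}.
Proof. by case: hq => _ _ _ [/derivable_oo_LRcontinuous_within]. Qed.

Let qinv_derivable y : y \in `]q 0, q 1[ -> derivable (qinv q) y 1.
Proof. by case: hq => _ _ _ [[+ _ _] _] => /(_ y). Qed.

Let F t := qinv q (t ^+ 2).

Let ab_ge0 t : t \in `]a, b[ -> 0 <= t.
Proof. by rewrite in_itv/= => /andP[/ltW/(le_trans a_ge0)]. Qed.

Let abc_ge0 t : t \in `[a, b] -> 0 <= t.
Proof. by rewrite in_itv/= => /andP[/(le_trans a_ge0)]. Qed.

Let sqr_cc t : t \in `[a, b] -> t ^+ 2 \in `[q 0, q 1].
Proof.
move=> tab; have t0 := abc_ge0 tab; move: tab; rewrite !in_itv/= => /andP[ta tb].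
rewrite -(sqr_sqrtr q0_ge0) -(sqr_sqrtr (ltW q1_gt0)).
by rewrite !lerXn2r// ?nnegrE ?sqrtr_ge0.
Qed.

Let is_derive_F t : t \in `]a, b[ -> is_derive t 1 F (2 * (t * Q_of q t)).
Proof.
move=> tab; have t2I : t ^+ 2 \in `]q 0, q 1[ by rewrite sqr_oo// ab_ge0.
have d1 : is_derive t 1 (fun t : R => t ^+ 2) (2 * t).
  by apply: DeriveDef; [exact: exprn_derivable|rewrite exp_derive /GRing.scale/= mulr1 expr1].
have d2 : is_derive (t ^+ 2) 1 (qinv q) (derive1 (qinv q) (t ^+ 2)).
  by apply: DeriveDef; [exact: qinv_derivable|rewrite derive1E].
have d3 := @is_derive1_comp R (qinv q) (fun t : R => t ^+ 2) t _ _ d2 d1.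
by apply: (is_derive_eq d3); rewrite Q_in//; ring.
Qed.

Let derive1_F t : t \in `]a, b[ -> derive1 F t = 2 * (t * Q_of q t).
Proof. by move=> tab; rewrite derive1E; have [] := is_derive_F tab. Qed.

(** The derivative of [qinv q] is controlled only in the open interval; [V] extends [t Q(t)]
    continuously to the endpoints. *)
Let V_spec : exists2 V : R -> R, {within `[a, b], continuous V} &
  {in `]a, b[, forall t, t * Q_of q t = V t}.
Proof.
have [g cg gE] := g_spec.
exists (fun t => t * g (t ^+ 2)) => [|t tab].
  have := within_continuous_sqr q0_ge0 (ltW q1_gt0) cg.
  move=> h t; apply: (@continuousM _ (subspace `[a, b]) id (fun t => g (t ^+ 2))).
    exact: (continuous_subspaceT (fun x => @cvg_id _ _)).
  exact: h.
by rewrite Q_in// gE// sqr_oo// ab_ge0.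
Qed.

(** On []a, b[] the integrand agrees with a continuous function on a compact interval, and elsewhere
    on the half-line it is 0. *)
Lemma integrable_Q (h : R -> R) : {within `[a, b], continuous h} ->
  mu.-integrable R0y (EFin \o (fun t => t * Q_of q t * h t)) /\
  mu.-integrable `]a, b[ (EFin \o (fun t => t * Q_of q t * h t)) /\
  \int[mu]_(t in R0y) (t * Q_of q t * h t) =
  \int[mu]_(t in `]a, b[) (t * Q_of q t * h t).
Proof.
move=> ch; have [V cV VE] := V_spec.
have iV : mu.-integrable `[a, b] (EFin \o (fun t => V t * h t)).
  apply: continuous_compact_integrable; first exact: segment_compact.
  by move=> t; apply: (@continuousM _ (subspace `[a, b]) V h); [exact: cV|exact: ch].
have iVo : mu.-integrable `]a, b[ (EFin \o (fun t => V t * h t)).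
  by apply: integrableS iV => //; exact: subset_itv_oo_cc.
have io : mu.-integrable `]a, b[ (EFin \o (fun t => t * Q_of q t * h t)).
  by apply: eq_integrable iVo => // t /set_mem tab; rewrite /= VE.
have sub : R0y `&` `]a, b[ = `]a, b[%classic.
  by apply: setIidr => t /ab_ge0; rewrite /= in_itv/= andbT.
have resE : {in R0y, (fun t => t * Q_of q t * h t) \_ `]a, b[ =1
    (fun t => t * Q_of q t * h t)}.
  move=> t /set_mem; rewrite /= in_itv/= andbT => t0; rewrite patchE mem_setE.
  by case: ifPn => // tab; rewrite Q_out// mulr0 mul0r.
split; last split=> //.
  have mR : measurable R0y by [].
  rewrite -sub in io.
  have mab : measurable (`]a, b[%classic : set R) by [].
  have := (integrable_restrict mu mab mR _).1 io.
  apply: eq_integrable => // t tR; rewrite /= -(resE _ tR) !patchE.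
  by case: ifP.
by rewrite -sub Rintegral_mkcondr; apply: eq_Rintegral => t tR; rewrite resE.
Qed.

(* Substitution [r = q^-1(t^2)], with [dr = 2 t Q(t) dt]. *)
Lemma moment_Q k :
  \int[mu]_(t in R0y) (t * Q_of q t * t ^+ k.*2) =
  2^-1 * \int[mu]_(r in `[0, 1]) q r ^+ k.
Proof.
have ch : {within `[a, b], continuous (fun t : R => t ^+ k.*2)}.
  by apply: continuous_subspaceT => t; exact: exprn_continuous.
have [_ [io ->]] := integrable_Q ch.
have e0 : 0 \in `[0, (1:R)] by rewrite in_itv/= lexx ler01.
have e1 : 1 \in `[0, (1:R)] by rewrite in_itv/= lexx ler01.
have Fa : F a = 0 by rewrite /F sqr_sqrtr// qinvK.
have Fb : F b = 1 by rewrite /F sqr_sqrtr ?(ltW q1_gt0)// qinvK.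
have F_incr : {in `[a, b] &, {homo F : x y / x < y}}.
  move=> x y xab yab xy; apply: qinv_incr; [exact: sqr_cc|exact: sqr_cc|].
  by rewrite ltr_pXn2r ?nnegrE ?abc_ge0.
have [V cV VE] := V_spec.
have [cVo cVa cVb] := (continuous_within_itvP V ab).1 cV.
have F1E t : t \in `]a, b[ -> derive1 F t = 2 * V t.
  by move=> tab; rewrite derive1_F// VE.
have F1_cont : {in `]a, b[, continuous (derive1 F)}.
  move=> t tab.
  have nE : \forall s \near t, 2 * V s = derive1 F s.
    by apply: filterS (near_in_itvoo tab) => s sab; rewrite F1E.
  have : 2 * V s @[s --> t] --> 2 * V t by apply: cvgMr; exact: cVo.
  by rewrite -F1E//; apply: cvg_trans; exact: near_eq_cvg.
(* The substitution rule needs one-sided limits of [F'] at the endpoints; the continuous extension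
   [V] supplies them. *)
have F1_a : cvg (derive1 F x @[x --> a^'+]).
  apply/cvg_ex; exists (2 * V a).
  have : 2 * V s @[s --> a^'+] --> 2 * V a by exact: cvgMr.
  apply: cvg_trans; apply: near_eq_cvg; near=> s.
  by rewrite F1E// in_itv/=; apply/andP; split; near: s;
    [exact: nbhs_right_gt|exact: nbhs_right_lt].
have F1_b : cvg (derive1 F x @[x --> b^'-]).
  apply/cvg_ex; exists (2 * V b).
  have : 2 * V s @[s --> b^'-] --> 2 * V b by exact: cvgMr.
  apply: cvg_trans; apply: near_eq_cvg; near=> s.
  by rewrite F1E// in_itv/=; apply/andP; split; near: s;
    [exact: nbhs_left_gt|exact: nbhs_left_lt].
have F_der : derivable_oo_LRcontinuous F a b.
  have cF := within_continuous_sqr q0_ge0 (ltW q1_gt0) qinv_cont.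
  have [_ ca cb] := (continuous_within_itvP _ ab).1 cF.
  by split; [move=> t tab; have [] := is_derive_F tab|exact: ca|exact: cb].
have cG : {within `[F a, F b], continuous (fun r => q r ^+ k)}.
  rewrite Fa Fb; apply/subspace_continuousP => r rI.
  have /subspace_continuousP/(_ r rI) qr := cq.
  by apply: (@cvg_comp _ _ _ q (fun y => y ^+ k) _ _ _ qr); exact: exprn_continuous.
have := integration_by_substitution_increasing (ltW ab) F_incr F1_cont F1_a F1_b F_der cG.
rewrite Fa Fb => sub; rewrite [X in _ = _ * X]/Rintegral sub.
(* Here [q (F t) = t^2], which turns [q^k] into [t^(2k)]. *)
have GE : {in `]a, b[, forall t, (((fun r => q r ^+ k) \o F) * derive1 F) t =
    2 * (t * Q_of q t * t ^+ k.*2)}.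
  move=> t tab; rewrite -[LHS]/(q (F t) ^+ k * derive1 F t) derive1_F//.
  have tI : t ^+ 2 \in `[q 0, q 1] by apply: sqr_cc; exact: subset_itv_oo_cc tab.
  have [_ qF] := qinv_sub tI.
  by rewrite /F qF -exprM -mul2n; ring.
have io2 : mu.-integrable `]a, b[ (EFin \o (((fun r => q r ^+ k) \o F) * derive1 F)).
  apply: eq_integrable (integrable_EFinZl 2 _ io) => //.
  by move=> t /set_mem tab /=; rewrite GE.
rewrite integral_itv_bndoo; last exact: measurable_int io2.
rewrite -[RHS]/(2^-1 * \int[mu]_(t in `]a, b[) (((fun r => q r ^+ k) \o F) * derive1 F) t).
rewrite -RintegralZl//; apply: eq_Rintegral => t /set_mem tab.
by rewrite GE// mulKf.
Unshelve. all: by end_near. Qed.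

End moments_of_Q.

(** * Term-by-term Hankel and Laplace transforms of [Q] *)

Section transforms.
Context {R : realType}.
Local Notation mu := (@lebesgue_measure R).
Local Notation I01 := (`[0, 1]%classic : set R).
Local Notation R0y := (`[0, +oo[%classic : set R).
Variable q : R -> R.
Hypotheses (hq : increasing_C1_profile q) (q0_ge0 : 0 <= q 0).

Lemma increasing_profile_continuous : {within I01, continuous q}.
Proof. by case: hq => -[/derivable_oo_LRcontinuous_within]. Qed.

Lemma increasing_profile_measurable : measurable_fun I01 q.
Proof.
by apply: subspace_continuous_measurable_fun => //; exact: increasing_profile_continuous.
Qed.

Lemma increasing_profile_ge0 r : I01 r -> 0 <= q r <= 1.
Proof.
move=> rI; case: hq => _ iq bq _; apply/andP; split; last first.
  by rewrite (le_trans (ler_norm _))// bq.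
have := rI; rewrite /= in_itv/= => /andP[r0 _]; move: r0.
rewrite le_eqVlt => /predU1P[<-//|r0]; apply: (le_trans q0_ge0); apply: ltW.
by apply: iq => //; rewrite in_itv/= lexx ler01.
Qed.

Let m k := \int[mu]_(r in I01) q r ^+ k.

Lemma integrable_profile_expr k : mu.-integrable I01 (EFin \o (fun r => q r ^+ k)).
Proof.
apply: (@integrable01 _ _ 1).
  by apply: measurable_funX; exact: increasing_profile_measurable.
by move=> r /increasing_profile_ge0/andP[? ?]; rewrite normrX exprn_ile1// ger0_norm.
Qed.

Let m_bounds k : 0 <= m k <= 1.
Proof.
apply/andP; split.
  by apply: Rintegral_ge0 => r /increasing_profile_ge0/andP[? ?]; rewrite exprn_ge0.
have := @le_Rintegral _ _ _ mu I01 (fun r => q r ^+ k) (cst 1).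
rewrite Rintegral_cst//= lebesgue_measure_itv/= lte_fin ltr01 /= subr0 mulr1; apply.
- by [].
- exact: integrable_profile_expr.
- by apply: (@integrable01 _ _ 1) => // t _; rewrite normr1.
- by move=> r /increasing_profile_ge0/andP[? ?]; rewrite exprn_ile1.
Qed.

(** The Hankel transform of [Q] with [J_0] replaced by its partial sum; [m k / 2] is the moment of
    order [2k] of [t Q(t)]. *)
Let h n s := \sum_(0 <= k < n) (bessel_coeff k * m k / 2) * s ^+ k.*2.

(** The moments lie in [0, 1], so the bound for the Bessel series remains; its growth [expR s] is
    why the Laplace variable is taken above 1. *)
Let norm_h_le n s : 0 <= s -> `|h n s| <= expR s.
Proof.
move=> s0; apply: le_trans (bessel_abs_sum_le n s0).
rewrite (le_trans (ler_norm_sum _ _ _))//; apply: ler_sum => k _.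
rewrite normrM (ger0_norm (exprn_ge0 _ s0)) ler_wpM2r ?exprn_ge0//.
rewrite -mulrA normrM -[leRHS]mulr1 ler_wpM2l//.
by have /andP[? ?] := m_bounds k; rewrite ger0_norm; lra.
Qed.

Let tQ k t := t * Q_of q t * t ^+ k.*2.

Let integrable_tQ k : mu.-integrable R0y (EFin \o tQ k).
Proof.
have ch : {within `[Num.sqrt (q 0), Num.sqrt (q 1)], continuous (fun t : R => t ^+ k.*2)}.
  by apply: continuous_subspaceT => t; exact: exprn_continuous.
by have [] := integrable_Q hq q0_ge0 ch.
Qed.

Let hankel_partialE n s t : t * Q_of q t * bessel_sum n (s * t) =
  \sum_(0 <= k < n) (bessel_coeff k * s ^+ k.*2) * tQ k t.
Proof.
rewrite mulr_sumr; apply: eq_bigr => k _; rewrite exprMn /tQ.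
by move: (t ^+ _) (s ^+ _) => T S; ring.
Qed.

Lemma hankel0_cvg s : 0 <= s ->
  mu.-integrable R0y (EFin \o hankel0_integrand (Q_of q) s) /\
  h n s @[n --> \oo] --> hankel0 (Q_of q) s.
Proof.
move=> s0.
have iZ k : mu.-integrable R0y (EFin \o (fun t => bessel_coeff k * s ^+ k.*2 * tQ k t)).
  exact: integrable_EFinZl.
have i_n n : mu.-integrable R0y (EFin \o (fun t => t * Q_of q t * bessel_sum n (s * t))).
  apply: eq_integrable (integrable_EFin_sum n _ iZ) => // t _.
  by rewrite /= hankel_partialE.
have hE n : \int[mu]_(t in R0y) (t * Q_of q t * bessel_sum n (s * t)) = h n s.
  under eq_Rintegral do rewrite hankel_partialE.
  rewrite Rintegral_sum//; apply: eq_bigr => k _; rewrite RintegralZl// moment_Q// -/(m k).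
  by move: (s ^+ _) => S; ring.
(* The majorant works because [Q] vanishes for [t > 1], as [q 1 <= 1], while for [t <= 1] the
   partial sums at [s t] are at most [expR s]. *)
have [|||||il cl] := @Rdominated_convergence _ _ R mu R0y
  (fun n t => t * Q_of q t * bessel_sum n (s * t)) (hankel0_integrand (Q_of q) s)
  (fun t => expR s * `|tQ 0 t|).
- by [].
- by move=> n; apply/measurable_EFinP; exact: measurable_int (i_n n).
- move=> t; rewrite /= in_itv/= andbT => t0; apply: cvgM; first exact: cvg_cst.
  by apply: cvg_bessel_sum; rewrite mulr_ge0.
- by apply: integrable_EFinZl => //; exact: integrable_norm.
- move=> n t; rewrite /= in_itv/= andbT => t0; rewrite normrM mulrC /tQ expr0 mulr1.
  have [t1|t1] := leP t 1.
    rewrite ler_wpM2r// (le_trans (norm_bessel_sum_le n (mulr_ge0 s0 t0)))//.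
    by rewrite ler_expR ler_piMr.
  have -> : Q_of q t = 0.
    rewrite /Q_of indicE memNset ?mul0r//= in_itv/= => /andP[_].
    have /increasing_profile_ge0/andP[_ q1] : I01 1 by rewrite /= in_itv/= lexx ler01.
    by apply/negP; rewrite -leNgt (le_trans q1)// exprn_ege1// ltW.
  by rewrite mulr0 normr0 !mulr0.
split=> //; move: cl; rewrite /hankel0.
by under eq_fun do rewrite hE.
Qed.

(** For partial sums, both sides reduce to the same finite combination of moments of [q]. Two
    dominated limits, one in [s] and one in [r], then identify the full transforms. *)
Lemma laplace_hankel0 sigma : 1 < sigma ->
  mu.-integrable R0y (EFin \o laplace_integrand (hankel0 (Q_of q)) sigma) /\
  laplace (hankel0 (Q_of q)) sigma =
  (2 * sigma)^-1 * power_mean (- 2^-1) q (sigma ^- 2).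
Proof.
move=> s1; have s0 : 0 < sigma by lra.
pose c := sigma ^- 2.
have c0 : 0 < c by rewrite invr_gt0 exprn_gt0.
have c1 : c < 1 by rewrite invf_lt1 ?exprn_gt0// exprn_egt1.
have i_k k : mu.-integrable R0y (EFin \o (fun s => bessel_coeff k * m k / 2 *
    (expR (- (sigma * s)) * s ^+ k.*2))).
  by apply: integrable_EFinZl => //; have [] := laplace_monomial k.*2 s0.
have fE n s : expR (- (sigma * s)) * h n s =
    \sum_(0 <= k < n) bessel_coeff k * m k / 2 * (expR (- (sigma * s)) * s ^+ k.*2).
  by rewrite mulr_sumr; apply: eq_bigr => k _; rewrite mulrCA.
have i_n n : mu.-integrable R0y (EFin \o (fun s => expR (- (sigma * s)) * h n s)).
  by apply: eq_integrable (integrable_EFin_sum n _ i_k) => // s _; rewrite /= fE.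
have intE n : \int[mu]_(s in R0y) (expR (- (sigma * s)) * h n s) =
    (2 * sigma)^-1 * \int[mu]_(r in I01) binomial_sum n (c * q r).
  under eq_Rintegral do rewrite fE.
  rewrite Rintegral_sum//.
  under [X in _ = _ * X]eq_Rintegral.
    move=> r _.
    have -> : binomial_sum n (c * q r) =
      \sum_(0 <= k < n) (bessel_coeff k * (k.*2)`!%:R * c ^+ k) * q r ^+ k.
      by apply: eq_bigr => k _; rewrite exprMn mulrA.
    over.
  rewrite Rintegral_sum//; last first.
    by move=> k; apply: integrable_EFinZl => //; exact: integrable_profile_expr.
  rewrite mulr_sumr; apply: eq_bigr => k _.
  have [ik ikE] := laplace_monomial k.*2 s0.
  rewrite RintegralZl// ikE RintegralZl//; last exact: integrable_profile_expr.
  rewrite -/(m k) /c exprVn -exprM mul2n exprS.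
  have : sigma ^+ k.*2 != 0 by rewrite gt_eqF// exprn_gt0.
  move: (sigma ^+ _) ((k.*2)`!%:R) (m k) => S F M S0.
  by field; rewrite S0 gt_eqF.
(* Since [|h n s| <= expR s], the integrands are dominated by [exp(- (sigma - 1) s)]; the factor
   [s ^+ 0] puts this in the form of a monomial transform. *)
have [|||||il cl] := @Rdominated_convergence _ _ R mu R0y
  (fun n s => expR (- (sigma * s)) * h n s) (laplace_integrand (hankel0 (Q_of q)) sigma)
  (fun s => expR (- ((sigma - 1) * s)) * s ^+ 0).
- by [].
- by move=> n; apply/measurable_EFinP; exact: measurable_int (i_n n).
- move=> s; rewrite /= in_itv/= andbT => sp; apply: cvgM; first exact: cvg_cst.
  by have [] := hankel0_cvg sp.
- have s10 : 0 < sigma - 1 by lra.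
  by have [] := laplace_monomial 0 s10.
- move=> n s; rewrite /= in_itv/= andbT => sp; rewrite expr0 mulr1.
  rewrite normrM (ger0_norm (expR_ge0 _)).
  have -> : - ((sigma - 1) * s) = - (sigma * s) + s by ring.
  by rewrite expRD ler_wpM2l ?expR_ge0// norm_h_le.
split=> //.
have mcq : measurable_fun I01 (fun r => c * q r).
  by apply: measurable_funM => //; exact: increasing_profile_measurable.
have cq_bounds r : I01 r -> 0 <= c * q r <= c.
  move=> /increasing_profile_ge0/andP[q0 q1].
  by rewrite mulr_ge0 ?(ltW c0)//= ler_piMr// ltW.
(* The arguments [c q(r)] lie in [0, c] with [c < 1], so the geometric bound is a constant
   majorant. *)
have [|||||_ cb] := @Rdominated_convergence _ _ R mu I01
  (fun n r => binomial_sum n (c * q r)) (fun r => (1 + c * q r) `^ (- 2^-1))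
  (cst (1 - c)^-1).
- by [].
- move=> n; apply: measurable_sum => k; apply: measurable_funM => //.
  exact: measurable_funX.
- move=> r /cq_bounds/andP[? ?]; apply: cvg_binomial_sum.
  by apply/andP; split; lra.
- apply: (@integrable01 _ _ (1 - c)^-1) => // t _.
  by rewrite /= ger0_norm// invr_ge0; lra.
- by move=> n r rI; rewrite (norm_binomial_sum_le _ (cq_bounds _ rI)).
have cl2 : \int[mu]_(s in R0y) (expR (- (sigma * s)) * h n s) @[n --> \oo] -->
    (2 * sigma)^-1 * power_mean (- 2^-1) q c.
  by under eq_fun do rewrite intE; apply: cvgM => //; exact: cvg_cst.
exact: cvg_unique cl cl2.
Qed.

End transforms.

(** * Passage between [DB] and power means *)

Section dispersion.
Context {R : realType}.
Local Notation mu := (@lebesgue_measure R).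
Local Notation I01 := (`[0, 1]%classic : set R).

Lemma DB_power_mean (eta alpha : R) (q : R -> R) (lam : R) :
  {in `[0, 1], forall s, 0 <= 1 + eta `^ alpha / lam ^+ 2 * q s} ->
  DB eta alpha q lam = power_mean 2^-1 q (eta `^ alpha / lam ^+ 2).
Proof.
move=> q0; apply: eq_Rintegral => s /set_mem sI.
by rewrite powR12_sqrt// q0.
Qed.

(** The descent of exponents is carried out on the interval and evaluated at its midpoint; the equal
    superlevel measures obtained there give [q1 <= q2] and, with the roles exchanged, [q2 <= q1]. *)
Lemma increasing_profile_unique (q1 q2 : R -> R) (a b : R) :
  0 <= a -> a < b -> b <= 1 ->
  increasing_C1_profile q1 -> increasing_C1_profile q2 ->
  {in `]a, b[, power_mean 2^-1 q1 =1 power_mean 2^-1 q2} ->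
  {in `[0, 1], q1 =1 q2}.
Proof.
move=> a0 ab b1 h1 h2 e12.
have m1 := increasing_profile_measurable h1.
have m2 := increasing_profile_measurable h2.
have [_ i1 bq1 _] := h1; have [_ i2 bq2 _] := h2.
pose c := (a + b) / 2.
have cab : c \in `]a, b[ by rewrite in_itv/= /c; apply/andP; split; lra.
have c01 : 0 < c < 1 by rewrite /c; apply/andP; split; lra.
have half k : 2^-1 != k%:R :> R.
  case: k => [|k]; first by rewrite invr_eq0.
  by rewrite lt_eqF// (@lt_le_trans _ _ 1)// ?ler1n// invf_lt1// ltr1n.
have eqn n : power_mean (2^-1 - n%:R) q1 c = power_mean (2^-1 - n%:R) q2 c.
  exact: (power_mean_eqBn m1 m2 bq1 bq2 n half a0 b1 e12).
have sl := superlevel_eq m1 m2 bq1 bq2 c01 eqn.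
have sl' y : -1 <= y < 1 -> _ := fun yI =>
  let: And3 x1 x2 x3 := sl y yI in And3 x2 x1 (esym x3).
have c1 := increasing_profile_continuous h1.
have c2 := increasing_profile_continuous h2.
move=> s sI; apply/eqP; rewrite eq_le.
by rewrite (increasing_le_of_superlevel c1 c2 i1 i2 bq1 bq2 sl sI)
  (increasing_le_of_superlevel c2 c1 i2 i1 bq2 bq1 sl' sI).
Qed.

(** Chain rule with [c = e / lam^2]: the factor [dc/dlam = - 2 c / lam] cancels the [1 / (2 c)] of
    the power-mean derivative. *)
Lemma is_derive_DB (eta alpha : R) (q : R -> R) (lam : R) :
  increasing_C1_profile q -> 0 <= q 0 ->
  0 < lam -> 0 < eta `^ alpha -> eta `^ alpha / lam ^+ 2 < 1 ->
  is_derive lam 1 (DB eta alpha q)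
    (lam^-1 * power_mean (- 2^-1) q (eta `^ alpha / lam ^+ 2) -
     lam^-1 * DB eta alpha q lam).
Proof.
move=> hq q0 l0 e0 c1; set e := eta `^ alpha in e0 c1 *.
(* As [q >= 0], the radicand is nonnegative for every real [x]; at [x = 0] the quotient takes the
   default value 0. *)
have DBE : DB eta alpha q = (fun x => power_mean 2^-1 q (e / x ^+ 2)).
  apply/funext => x; apply: DB_power_mean => s sI.
  have /andP[q0s _] := increasing_profile_ge0 hq q0 sI.
  by rewrite addr_ge0// mulr_ge0// divr_ge0 ?sqr_ge0// ltW.
have c0 : 0 < e / lam ^+ 2 by rewrite divr_gt0// exprn_gt0.
have c01 : 0 < e / lam ^+ 2 < 1 by rewrite c0.
have [_ _ bq _] := hq.
have d1 := is_derive_power_mean (increasing_profile_measurable hq) bq 2^-1 c01.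
have dX : is_derive lam 1 (fun y : R => y ^+ 2) (2 * lam).
  by apply: DeriveDef; [exact: exprn_derivable|rewrite exp_derive /GRing.scale/= mulr1 expr1].
have l2 : lam ^+ 2 != 0 by rewrite gt_eqF// exprn_gt0.
have d2 := is_deriveZ e (@is_deriveV R (fun y => y ^+ 2) lam _ 1 l2 dX).
have d3 := @is_derive1_comp R (power_mean 2^-1 q) (e \*: (fun y => (y ^+ 2)^-1)) lam _ _ d1 d2.
rewrite DBE; apply: (is_derive_eq d3).
have -> : 2^-1 - 1 = - 2^-1 :> R by lra.
rewrite /GRing.scale/=.
move: (power_mean 2^-1 _ _) (power_mean (- 2^-1) _ _) => A B.
by field; rewrite ?gt_eqF.
Qed.

End dispersion.

(** * Invariance, uniqueness and reconstruction for [DB] *)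

Unset Implicit Arguments.

Theorem theorem13 (R : realType) (tau alpha eta : R)
  (tau_gt1 : 1 < tau) (alpha_gt0 : 0 < alpha) (eta_gt0 : 0 < eta)
  (tau_eta : tau * eta `^ alpha < 1) :
  (* (1) *)
  (forall q1 q2 : R -> R,
     piecewise_continuous q1 0 1 -> piecewise_continuous q2 0 1 ->
     bounded1 q1 -> bounded1 q2 ->
     same_level_measures q1 q2 ->
     {in `[Num.sqrt (tau * eta `^ alpha), 1],
        DB eta alpha q1 =1 DB eta alpha q2})
  /\
  (* (2), uniqueness *)
  (forall q1 q2 : R -> R,
     increasing_C1_profile q1 -> increasing_C1_profile q2 ->
     {in `[Num.sqrt (tau * eta `^ alpha), 1],
        DB eta alpha q1 =1 DB eta alpha q2} ->
     {in `[0, 1], q1 =1 q2})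
  /\
  (* (2), reconstruction formula *)
  (forall q : R -> R,
     increasing_C1_profile q -> 0 <= q 0 ->
     (forall s : R, 0 <= s ->
        (@lebesgue_measure R).-integrable `[0, +oo[
           (EFin \o hankel0_integrand (Q_of q) s)) /\
     {in `[Num.sqrt (tau * eta `^ alpha), 1], forall lam : R,
        [/\ (@lebesgue_measure R).-integrable `[0, +oo[
               (EFin \o laplace_integrand (hankel0 (Q_of q))
                          (lam / Num.sqrt (eta `^ alpha))),
            derivable (DB eta alpha q) lam 1 &
            lam^-1 * DB eta alpha q lam + derive1 (DB eta alpha q) lam
            = 2 / Num.sqrt (eta `^ alpha)
              * laplace (hankel0 (Q_of q)) (lam / Num.sqrt (eta `^ alpha))]}).

Proof.
have e0 : 0 < eta `^ alpha by exact: powR_gt0.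
set e := eta `^ alpha in e0 tau_eta *.
have t0 : 0 < tau by lra.
have te0 : 0 < tau * e by exact: mulr_gt0.
have lamP lam : lam \in `[Num.sqrt (tau * e), 1] -> 0 < lam /\ 0 < e / lam ^+ 2 < 1.
  rewrite in_itv/= => /andP[tl l1].
  have l0 : 0 < lam by apply: lt_le_trans tl; rewrite sqrtr_gt0.
  split=> //; rewrite divr_gt0 ?exprn_gt0//= ltr_pdivrMr ?exprn_gt0// mul1r.
  (* This bound and [tau > 1] make the ratio [e / lam^2] less than 1. *)
  have : tau * e <= lam ^+ 2.
    by rewrite -(sqr_sqrtr (ltW te0)) lerXn2r// nnegrE ?sqrtr_ge0// ltW.
  by apply: lt_le_trans; nra.
have posq (q : R -> R) c : bounded1 q -> 0 < c < 1 ->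
    {in `[0, 1], forall s, 0 <= 1 + c * q s}.
  move=> bq /andP[c0 c1] s sI; have := bq _ sI.
  by rewrite ler_norml => /andP[? ?]; nra.
split; [|split].
- move=> q1 q2 [p1 ip1 pc1] [p2 ip2 pc2] b1 b2 q12 lam lamI.
  pose g (y : R) := Num.sqrt (1 + e / lam ^+ 2 * y).
  apply: (@Rintegral01_same_level_measures _ g) => //.
  + by apply: (measurable_fun_piecewise ip1) => i /pc1[].
  + by apply: (measurable_fun_piecewise ip2) => i /pc2[].
  + apply: continuous_measurable_fun => y.
    apply: (@continuous_comp _ _ _ (fun y => 1 + e / lam ^+ 2 * y) Num.sqrt).
      by apply: cvgD; [exact: cvg_cst|exact: mulrl_continuous].
    exact: sqrt_continuous.
  + by move=> y; exact: sqrtr_ge0.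
- move=> q1 q2 h1 h2 e12.
  have [_ _ b1 _] := h1; have [_ _ b2 _] := h2.
  (* As [lam] runs over its range, [e / lam^2] covers the nonempty interval []e, tau^-1[], inside
     (0, 1). *)
  have et : e < tau^-1 by rewrite -[ltRHS]mul1r ltr_pdivlMr// mulrC.
  have t1 : tau^-1 <= 1 by rewrite invf_le1// ltW.
  apply: (increasing_profile_unique (ltW e0) et t1 h1 h2) => c.
  rewrite in_itv/= => /andP[ec ct].
  have c0 : 0 < c by exact: lt_trans ec.
  have c1 : c < 1 by apply: (lt_trans ct); rewrite invf_lt1.
  have ec0 : 0 < e / c by exact: divr_gt0.
  (* The positive solution of [e / lam^2 = c]. *)
  pose lam := Num.sqrt (e / c).
  have lamI : lam \in `[Num.sqrt (tau * e), 1].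
    rewrite in_itv/= /lam; apply/andP; split.
      rewrite ler_sqrt; last exact: ltW.
      rewrite mulrC ler_pM2l// -[leLHS]invrK lef_pV2 ?posrE ?invr_gt0//.
      exact: ltW.
    by rewrite -[leRHS]sqrtr1 ler_sqrt// ler_pdivrMr// mul1r ltW.
  have cE : e / lam ^+ 2 = c.
    by rewrite /lam sqr_sqrtr ?(ltW ec0)// invf_div mulrCA mulfV ?mulr1// gt_eqF.
  have c01 : 0 < c < 1 by rewrite c0.
  have := e12 _ lamI.
  rewrite !DB_power_mean -/e ?cE//; exact: posq.
- move=> q hq q0; split=> [s s0|lam lamI].
    by have [] := hankel0_cvg hq q0 s0.
  have [l0 /[dup] c01 /andP[c0 c1]] := lamP _ lamI.
  have se0 : 0 < Num.sqrt e by rewrite sqrtr_gt0.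
  pose sigma := lam / Num.sqrt e.
  have sE : sigma ^- 2 = e / lam ^+ 2.
    by rewrite /sigma expr_div_n sqr_sqrtr ?(ltW e0)// invf_div.
  have s1 : 1 < sigma.
    rewrite /sigma ltr_pdivlMr// mul1r -(ltr_pXn2r (n := 2))// ?nnegrE ?sqrtr_ge0 ?(ltW l0)//.
    rewrite sqr_sqrtr ?(ltW e0)//.
    by move: c1; rewrite ltr_pdivrMr ?exprn_gt0// mul1r.
  have [il ->] := laplace_hankel0 hq q0 s1.
  have [dD DE] := is_derive_DB hq q0 l0 e0 c1.
  (* The term [DB / lam] cancels in the derivative formula, and [2 / sqrt e] times [1 / (2 sigma)]
     equals [1 / lam]. *)
  split=> //; rewrite derive1E DE sE addrC subrK /sigma.
  by field; rewrite !gt_eqF.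
Qed.
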